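(* If $H$ is a $3$-uniform hypergraph with $\chi(H^{[1]})\ge 2$, then $\chi(H)\le \chi(H^{[1]})$.
   Context: Hypergraphs $H=(V(H),E(H))$ are finite, with $E(H)$ a nonempty set of subsets of $V(H)$ (edges); $H$ is $3$-uniform if all edges have size $3$. A coloring of $V(H)$ is proper if no edge is monochromatic; the chromatic number $\chi(H)$ is the least $m\ge 1$ such that $H$ has a proper coloring with $m$ colors (for graphs this is the usual chromatic number). The $1$-intersection graph $H^{[1]}$ of $H$ is the graph with vertex set $E(H)$ in which $e,f\in E(H)$ are adjacent if and only if $|e\cap f|=1$. *)

(* Defs.v *)
From HB Require Import structures.
From mathcomp Require Import all_boot.

Set Implicit Arguments.
Unset Strict Implicit.
Unset Printing Implicit Defensive.

Record hypergraph := Hypergraph {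
  vertex : finType;
  edges : {set {set vertex}};
  edges_neq0 : edges != set0
}.

Definition uniform (k : nat) (H : hypergraph) : bool :=
  [forall e in edges H, #|e| == k].

(* Colorings are defined for an arbitrary family E of subsets of V, possibly
   empty, so that they apply both to hypergraphs and to graphs, the latter
   being given by their sets of two-element edges. *)
Section Coloring.
Variables (V : finType) (E : {set {set V}}).

Definition monochromatic (C : eqType) (c : V -> C) (e : {set V}) : bool :=
  [forall x in e, forall y in e, c x == c y].

Definition proper_coloring (C : eqType) (c : V -> C) : bool :=
  [forall e in E, ~~ monochromatic c e].

Definition colorable (m : nat) : bool :=
  [exists c : {ffun V -> 'I_m}, proper_coloring c].

(* The least m >= 1 such that E has a proper coloring with m colors. Bounding
   the search by #|V| + 1 loses nothing, see chromatic_numberP. If E has no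
   proper coloring at all, as when some edge has at most one element, the value
   is #|V| + 1 by convention. *)
Definition chromatic_number : nat :=
  [arg min_(m < ord_max : 'I_#|V|.+2 | (0 < m) && colorable m) val m].

Lemma colorable_card m : colorable m -> colorable #|V|.+1.
Proof.
case/existsP=> c /forall_inP cP; apply/existsP.
exists [ffun x => widen_ord (leqnSn _) (enum_rank x)].
apply/forall_inP=> e /cP; apply: contra => /forall_inP ce.
apply/forall_inP=> x xe; apply/forall_inP=> y ye.
have /forall_inP/(_ y ye) := ce x xe.
rewrite !ffunE => /eqP/(congr1 val)/= /val_inj/enum_rank_inj -> //.
Qed.

Lemma chromatic_numberP m : 0 < m -> colorable m ->
  [/\ 0 < chromatic_number, colorable chromatic_number
    & chromatic_number <= m].
Proof.
move=> m0 cm; rewrite /chromatic_number.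
case: arg_minnP => [|i /andP[i0 ci] min_i]; first exact: colorable_card cm.
split=> //; case: (ltnP m #|V|.+2) => [lt_m|].
  by apply: (min_i (Ordinal lt_m)); rewrite /= m0.
exact/leq_trans/ltnW/ltn_ord.
Qed.

End Coloring.

Definition edge_of (H : hypergraph) : finType := {e | e \in edges H}.

(* The requirement e != f rules out loops, which could otherwise only arise
   from edges of size one. *)
Definition adj1 (H : hypergraph) (e f : edge_of H) : bool :=
  (e != f) && (#|val e :&: val f| == 1).

Definition intersection_graph1 (H : hypergraph) : {set {set edge_of H}} :=
  [set s | [exists e, exists f, adj1 e f && (s == [set e; f])]].

Lemma proper_coloring_graphP (H : hypergraph) (C : eqType)
    (c : edge_of H -> C) :
  reflect (forall e f, adj1 e f -> c e != c f)
          (proper_coloring (intersection_graph1 H) c).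
Proof.
apply: (iffP forall_inP) => [cP e f ef|cP s].
  have /cP : [set e; f] \in intersection_graph1 H.
    by rewrite inE; apply/existsP; exists e; apply/existsP; exists f; rewrite ef eqxx.
  apply: contra => /eqP cef; apply/forall_inP=> x /set2P[]->;
  by apply/forall_inP=> y /set2P[]->; rewrite ?cef.
rewrite inE => /existsP[e /existsP[f /andP[ef /eqP->]]].
apply: contra (cP e f ef) => /forall_inP/(_ e).
by rewrite set21 => /(_ isT)/forall_inP/(_ f); rewrite set22; apply.
Qed.

(* Main.v *)
Require Import Defs.
From mathcomp Require Import all_boot.
From mathcomp Require Import fingroup perm.

Set Implicit Arguments.
Unset Strict Implicit.
Unset Printing Implicit Defensive.

(** Colour the edges of H with m = chi(H^[1]) colours, properly for the
1-intersection graph. Two triples of the same colour class are then disjoint or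
share two points, so the class falls apart, into vertex-disjoint pieces, each
of which is either a family of triples through a common pair or a family of
triples inside a four-element set. In both cases one or two disjoint pairs
suffice for every triple of the piece to contain one of them. Hence each class
has a matching such that every triple of the class contains a matched pair
([pairing_exists]), and it is enough to colour the vertices so that matched
pairs, or at least the triples around them, are not monochromatic.

The union G of the m matchings has maximum degree at most m, so the tool is
Brooks' theorem ([brooks]), whose only obstacle, for m > 2, is a clique on
m + 1 vertices. Such a clique is perfectly matched by every class; in
particular m + 1 is even. So if m is even, G is m-colourable; for m = 2 Brooks'
theorem is replaced by the bipartiteness of a union of two matchings
([even_matchings_coloring]).

If m is odd, the cliques Q on m + 1 vertices are components of G, and they can
be coloured with one repetition: give the colour 0 to both ends of one pair
a b of the matching of class 0, and distinct nonzero colours to the other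
vertices of Q. The triples at risk are the a b y of class 0, and they are safe
if y is in Q. If some other such y is matched in class 0, then its pair can be
dropped from the matching of class 0, or a b and the pair of y can be rematched
so that Q is no longer a clique; repeating this ([settled_system]), every such y
outside Q ends up missed by that matching. So the rest of G, which has no clique
on m + 1 vertices, must be coloured with m colours such that the colour 0 avoids
the set Y of the vertices missed by the class-0 matching. This is possible
([admissible_coloring]): a vertex of Y has degree at most m - 1, which equals
the number of its colours, and a subgraph with at most one vertex outside Y is a
union of m - 1 matchings, with m - 1 even, hence (m - 1)-colourable. *)

(** * Proper colourings, connected sets and greedy extension *)

Section Graph.
Variables (V : finType) (adj : rel V).
Hypothesis adjC : symmetric adj.

Definition nbrs (S : {set V}) v := [set u in S | adj v u].

Definition proper_on (C : eqType) (S : {set V}) (c : V -> C) :=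
  {in S &, forall u v, adj u v -> c u != c v}.

(** Connectedness of the subgraph induced on S, phrased by cuts: the arguments
below only ever use an edge leaving a given subset of S. *)
Definition connected (S : {set V}) :=
  [forall U : {set V}, [&& U \subset S, U != set0 & U != S] ==>
     [exists u in U, exists w in S :\: U, adj u w]].

Definition clique (K : {set V}) :=
  [forall u in K, forall v in K, (u != v) ==> adj u v].

Lemma in_nbrs S v u : (u \in nbrs S v) = (u \in S) && adj v u.
Proof. by rewrite inE. Qed.

Lemma nbrs_sub (S T : {set V}) v : S \subset T -> nbrs S v \subset nbrs T v.
Proof.
by move=> sST; apply/subsetP=> u; rewrite !in_nbrs => /andP[/(subsetP sST)-> ->].
Qed.

Lemma nbrsU S T v : nbrs (S :|: T) v = nbrs S v :|: nbrs T v.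
Proof. by apply/setP=> u; rewrite !inE andb_orl. Qed.

Lemma cliqueP (K : {set V}) :
  reflect {in K &, forall u v, u != v -> adj u v} (clique K).
Proof.
apply: (iffP forall_inP) => [Kc u v uK vK uv|Kc u uK].
  by have /forall_inP/(_ v vK)/implyP := Kc u uK; apply.
by apply/forall_inP=> v vK; apply/implyP; apply: Kc.
Qed.

Lemma connected_cut (S U : {set V}) :
  connected S -> U \subset S -> U != set0 -> U != S ->
  exists u w, [/\ u \in U, w \in S, w \notin U & adj u w].
Proof.
move=> /forallP/(_ U) + US U0 UnS; rewrite US U0 UnS /=.
case/exists_inP=> u uU /exists_inP[w]; rewrite inE => /andP[wU wS] uw.
by exists u, w.
Qed.

Lemma connectedPn (S : {set V}) : ~~ connected S ->
  exists U : {set V}, [/\ U \subset S, U != set0, U != S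
    & forall u w, u \in U -> w \in S -> w \notin U -> ~~ adj u w].
Proof.
rewrite negb_forall => /existsP[U]; rewrite negb_imply.
case/andP=> /and3P[US U0 UnS] H; exists U; split=> // u w uU wS wU.
apply: contra H => uw; apply/exists_inP; exists u => //.
by apply/exists_inP; exists w; rewrite // inE wU.
Qed.

Lemma connected_split (S : {set V}) x : x \in S -> ~~ connected S ->
  exists Z : {set V}, [/\ Z \subset S, Z != set0, x \notin Z
    & forall u w, u \in Z -> w \in S -> w \notin Z -> ~~ adj u w].
Proof.
move=> xS /connectedPn[U [US U0 UnS Ucl]].
case: (boolP (x \in U)) => xU; last by exists U.
exists (S :\: U); split; rewrite ?subsetDl ?inE ?xU //.
  by rewrite setD_eq0; apply: contra UnS => SU; rewrite eqEsubset US.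
move=> u w /setDP[uS uU] wS; rewrite inE wS andbT negbK => wU.
by rewrite adjC Ucl.
Qed.

Lemma proper_extend (C : eqType) (S : {set V}) (c : V -> C) w a :
  ~~ adj w w -> proper_on S c -> (forall u, u \in nbrs S w -> c u != a) ->
  proper_on (w |: S) [eta c with w |-> a].
Proof.
move=> ww cP aP u v /=; rewrite !inE.
case: (altP (u =P w)) => [->|uw]; case: (altP (v =P w)) => [->|vw] //=.
- by rewrite (negbTE ww).
- by move=> _ vS wv; rewrite eq_sym aP // in_nbrs vS.
- by move=> uS _; rewrite adjC => wu; rewrite aP // in_nbrs uS.
exact: cP.
Qed.

Lemma free_color (C : finType) (L X : {set C}) : #|X :&: L| < #|L| ->
  exists2 a, a \in L & a \notin X.
Proof.
move=> ltXL; case: (boolP (L \subset X)) => [LX|/subsetPn[a]]; last by exists a.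
by rewrite (setIidPr LX) ltnn in ltXL.
Qed.

Hypothesis adj_irr : irreflexive adj.

Section Lists.
Variables (C : finType) (L : V -> {set C}).

(** The set B is coloured towards T: since B is connected, each of its vertices
outside T can be coloured while a neighbour closer to T is still uncoloured,
so that a list as large as the degree always leaves a colour. *)
Lemma greedy (A B T : {set V}) (c : V -> C) :
  connected B -> T \subset B -> T != set0 -> proper_on A c -> [disjoint A & B] ->
  (forall v, v \in B :\: T -> #|nbrs (A :|: B) v| <= #|L v|) ->
  exists c' : V -> C, [/\ proper_on (A :|: B :\: T) c',
    {in A, c' =1 c} & forall v, v \in B :\: T -> c' v \in L v].
Proof.
move=> connB; have [n] := ubnP #|B :\: T|; elim: n T => // n IHn T leBT TB T0 cA dAB degB.
have [TeqB|TnB] := eqVneq T B.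
  exists c; split=> //; first by rewrite TeqB setDv setU0.
  by move=> v; rewrite TeqB setDv inE.
have [u [w [uT wB wT uw]]] := connected_cut connB TB T0 TnB.
have wBT : w \in B :\: T by rewrite inE wT.
have wDe : B :\: T = w |: (B :\: (w |: T)).
  by apply/setP=> v; rewrite !inE; case: eqP => [->|] /=; rewrite ?wB ?wT.
have wnD : w \notin B :\: (w |: T) by rewrite !inE eqxx.
have [||||c' [c'P c'A c'L]] := IHn (w |: T) _ _ _ cA dAB.
- by move: leBT; rewrite wDe cardsU1 wnD add1n ltnS.
- by rewrite subUset sub1set wB.
- by apply/set0Pn; exists w; rewrite setU11.
- by move=> v vB; apply: degB; rewrite wDe inE vB orbT.
pose S := A :|: B :\: (w |: T).
have wA : w \notin A by apply: contraL wB => wA; rewrite (disjointFr dAB).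
have uA : u \notin A.
  by apply: contraL uT => /(disjointFr dAB) uB; apply: contraFN uB => /(subsetP TB).
have [|a aL aP] := @free_color _ (L w) (c' @: nbrs S w).
  apply: leq_ltn_trans (subset_leq_card (subsetIl _ _)) _.
  apply: leq_ltn_trans (leq_imset_card _ _) _.
  apply: leq_trans (degB w wBT); apply: proper_card; apply/properP; split.
    by apply: nbrs_sub; rewrite setUS // subsetDl.
  exists u; first by rewrite in_nbrs inE (subsetP TB) // orbT adjC.
  by rewrite in_nbrs !inE uT orbT /= (negbTE uA).
exists [eta c' with w |-> a]; split.
- rewrite wDe setUCA; apply: proper_extend; rewrite ?adj_irr //.
  by move=> v vS; apply: contraNneq aP => <-; apply: imset_f.
- by move=> v vA /=; case: eqP => [vw|_]; [rewrite -vw vA in wA | apply: c'A].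
- move=> v /=; rewrite wDe inE in_set1.
  by case: eqP => [-> //|_ /=]; apply: c'L.
Qed.

(** Once all of B but the root r is coloured, r can be coloured too if it has
more colours than neighbours, or if the neighbours precoloured in A waste
colours, either by repetition or by using colours outside the list of r. Only
the colours of the neighbours in A that lie in the list of r count. *)
Lemma greedy_root (A B : {set V}) r (c : V -> C) :
  connected B -> r \in B -> proper_on A c -> [disjoint A & B] ->
  (forall v, v \in B -> v != r -> #|nbrs (A :|: B) v| <= #|L v|) ->
  #|(c @: nbrs A r) :&: L r| + #|nbrs B r| < #|L r| ->
  exists c' : V -> C, [/\ proper_on (A :|: B) c',
    {in A, c' =1 c} & forall v, v \in B -> c' v \in L v].
Proof.
move=> connB rB cA dAB degB slack.
have [||v|c' [c'P c'A c'L]] := @greedy A B [set r] c connB _ _ cA dAB.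
- by rewrite sub1set.
- by apply/set0Pn; exists r; rewrite set11.
- by rewrite !inE => /andP[vr vB]; apply: degB.
have rA : r \notin A by apply: contraL rB => rA; rewrite (disjointFr dAB).
have [|a aL aP] := @free_color _ (L r) (c' @: nbrs (A :|: B :\ r) r).
  apply: leq_ltn_trans slack; rewrite nbrsU imsetU setIUl.
  apply: leq_trans (leq_card_setU _ _) _; apply: leq_add.
    apply: subset_leq_card; apply: setSI; apply/subsetP=> _ /imsetP[v vA ->].
    by rewrite c'A ?imset_f //; move: vA; rewrite in_nbrs => /andP[].
  apply: leq_trans (subset_leq_card (subsetIl _ _)) _.
  apply: leq_trans (leq_imset_card _ _) _.
  by apply/subset_leq_card/nbrs_sub/subsetDl.
exists [eta c' with r |-> a]; split.
- have -> : A :|: B = r |: (A :|: B :\ r).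
    by rewrite setUCA setD1K.
  apply: proper_extend; rewrite ?adj_irr //.
  by move=> v vS; apply: contraNneq aP => <-; apply: imset_f.
- by move=> v vA /=; case: eqP => [vr|_]; [rewrite -vr vA in rA | apply: c'A].
- move=> v vB /=; case: eqP => [-> //|/eqP vr].
  by apply: c'L; rewrite !inE vr.
Qed.

End Lists.

End Graph.

(** * Brooks' theorem *)

Section Brooks.
Variables (V : finType) (adj : rel V).
Hypotheses (adjC : symmetric adj) (adj_irr : irreflexive adj).
Notation nbrs := (nbrs adj).
Notation connected := (connected adj).
Notation proper_on := (proper_on adj).

(** The set F separates the nonempty set U from the nonempty rest of S. *)
Definition cuts (S F U : {set V}) :=
  [&& U \subset S, U != set0, [disjoint U & F], ~~ (S \subset U :|: F)
    & [forall u in U, forall w in S, adj u w ==> (w \in U :|: F)]].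

Lemma cutsP (S F U : {set V}) :
  reflect [/\ U \subset S, U != set0, [disjoint U & F], ~~ (S \subset U :|: F)
    & forall u w, u \in U -> w \in S -> adj u w -> (w \in U) || (w \in F)]
  (cuts S F U).
Proof.
apply: (iffP and5P) => [[-> -> -> -> cl]|[-> -> -> -> cl]]; split=> //.
  move=> u w uU wS uw; rewrite -in_setU.
  by have /forall_inP/(_ w wS)/implyP := forall_inP cl u uU; apply.
apply/forall_inP=> u uU; apply/forall_inP=> w wS; apply/implyP=> uw.
by rewrite inE; apply: cl uw.
Qed.

Lemma connected_cuts0 (S U : {set V}) : connected S -> ~~ cuts S set0 U.
Proof.
move=> connS; apply/cutsP=> -[US U0 _]; rewrite setU0 => SU cl.
have [|u [w [uU wS wU uw]]] := connected_cut connS US U0.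
  by apply: contraNneq SU => ->.
by move: (cl u w uU wS uw); rewrite inE (negbTE wU).
Qed.

Lemma disconnected_cuts (S F : {set V}) x :
  x \in S -> x \notin F -> ~~ connected (S :\: F) ->
  exists2 Z, cuts S F Z & x \notin Z.
Proof.
move=> xS xF; have xSF : x \in S :\: F by rewrite inE xF.
case/(connected_split adjC xSF) => Z [ZS Z0 xZ cl]; exists Z => //.
move: ZS; rewrite subsetD => /andP[ZS dZF]; apply/cutsP; split=> //.
  by apply/subsetPn; exists x; rewrite // inE negb_or xZ.
move=> u w uZ wS; apply: contraLR; rewrite negb_or => /andP[wZ wF].
by apply: cl; rewrite // inE wF.
Qed.

Lemma minimal_cut (S : {set V}) (P : pred {set V}) F0 U0 :
  P F0 -> cuts S F0 U0 -> exists F U, [/\ P F, cuts S F U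
    & forall F' U', P F' -> cuts S F' U' -> #|U| <= #|U'|].
Proof.
move=> PF0 cut0.
case: (@arg_minnP _ (F0, U0) (fun X => P X.1 && cuts S X.1 X.2)
   (fun X => #|X.2|)) => [|[F U] /andP[PF cutU] minU]; first by rewrite PF0.
by exists F, U; split=> // F' U' PF' cutU'; apply: (minU (F', U')); rewrite /= PF'.
Qed.

Lemma minimal_cut_connected (S F U : {set V}) :
  cuts S F U -> (forall U', cuts S F U' -> #|U| <= #|U'|) -> connected U.
Proof.
move=> /cutsP[US U0 dUF SUF cl] minU; apply: contraT => /connectedPn[Z [ZU Z0 ZnU clZ]].
have ltZU : Z \proper U by rewrite properEneq ZnU.
suff /minU : cuts S F Z by rewrite leqNgt proper_card.
apply/cutsP; split=> //; first exact: subset_trans ZU US.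
- exact: disjointWl ZU dUF.
- by apply: contra SUF => /subset_trans; apply; apply: setSU.
move=> u w uZ wS uw; have [wZ //|wZ /=] := boolP (w \in Z).
have /orP[wU|//] := cl u w (subsetP ZU _ uZ) wS uw.
by move: (clZ u w uZ wU wZ); rewrite uw.
Qed.

Variable C : finType.

(** The vertices of S outside D are coloured greedily towards D. Then y, all of
whose neighbours are in D, may take the colour of u. The rest of D is coloured
greedily towards x, whose neighbours y and u have the same colour, which leaves
a colour for x. *)
Lemma brooks_core (S D : {set V}) x y u :
  connected S -> (forall v, v \in S -> #|nbrs S v| <= #|C|) ->
  D \subset S -> x \in D -> y \in D -> u \in S -> u \notin D ->
  adj x y -> adj x u -> (forall w, w \in S -> adj y w -> w \in D) ->
  connected (D :\ y) -> exists c : V -> C, proper_on S c.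
Proof.
move=> connS degS DS xD yD uS uD xy xu yN connDy.
have xS := subsetP DS _ xD; have yS := subsetP DS _ yD.
have x0 : C.
  suff /card_gt0P/sigW[] : 0 < #|C| by [].
  apply: leq_trans (degS x xS); apply/card_gt0P.
  by exists y; rewrite in_nbrs yS.
pose L (v : V) := [set: C].
have d0 : [disjoint set0 & S] by rewrite disjoints_subset sub0set.
have p0 : proper_on set0 (fun _ : V => x0) by move=> ? ?; rewrite inE.
have D0 : D != set0 by apply/set0Pn; exists x.
have [|c0 [c0P _ _]] := @greedy _ _ adjC adj_irr C L set0 S D _ connS DS D0 p0 d0.
  by move=> v /setDP[vS _]; rewrite set0U cardsT degS.
rewrite set0U in c0P.
pose A := y |: S :\: D.
pose c1 := [eta c0 with y |-> c0 u].
have c1P : proper_on A c1.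
  apply: proper_extend; rewrite ?adj_irr //.
  move=> v; rewrite in_nbrs => /andP[/setDP[vS vD] yv].
  by rewrite (yN v) in vD.
have xNy : x != y by apply: contraTneq xy => ->; rewrite adj_irr.
have uNy : u != y by apply: contraNneq uD => ->.
have AUD : A :|: D :\ y = S.
  apply/setP=> v; rewrite !inE; case: eqP => [->|_] /=; first by rewrite yS.
  by case: (boolP (v \in D)) => [/(subsetP DS)->|]; rewrite ?orbT ?orbF.
have dAD : [disjoint A & D :\ y].
  rewrite -setI_eq0; apply/eqP/setP=> v; rewrite !inE.
  by case: eqP; case: (v \in D); rewrite /= ?andbF.
have xDy : x \in D :\ y by rewrite !inE xNy.
have [v||] := @greedy_root _ _ adjC adj_irr C L A (D :\ y) x c1 connDy xDy c1P dAD.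
- by move=> /(subsetP (subsetDl _ _))/(subsetP DS) vS _; rewrite AUD cardsT degS.
- rewrite setIT cardsT; apply: leq_trans (degS x xS).
  rewrite -AUD nbrsU cardsU (_ : _ :&: _ = set0) ?cards0 ?subn0; last first.
    apply/eqP; rewrite setI_eq0; apply: disjointW dAD; apply/subsetP=> v;
      by rewrite in_nbrs => /andP[].
  rewrite ltn_add2r.
  have yA : y \in nbrs A x by rewrite in_nbrs setU11.
  have uA : u \in nbrs A x :\ y by rewrite !inE uNy uD uS xu orbT.
  rewrite [X in _ < X](cardsD1 y) yA ltnS -[in X in X <= _](setD1K yA).
  rewrite imsetU1 (setUidPr _) ?leq_imset_card // sub1set.
  by apply/imsetP; exists u; rewrite //= eqxx (negbTE uNy).
by move=> c [cP _ _]; exists c; rewrite -AUD.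
Qed.

(** Cut off as small a part U as possible by a single vertex t. Then U together
with t stays connected when any y in U is removed, since a part of U separated
by y from t would be smaller than U. So [brooks_core] applies to the set t |: U
with x = t, a neighbour y of t in U and a neighbour u of t outside. *)
Lemma brooks_cut_vertex (S : {set V}) t U :
  connected S -> (forall v, v \in S -> #|nbrs S v| <= #|C|) ->
  cuts S [set t] U -> exists c : V -> C, proper_on S c.
Proof.
move=> connS degS cut0.
have [_ [{cut0 t}U [/cards1P[t ->] cutU minU]]] :=
  @minimal_cut S (fun F => #|F| == 1) [set t] U (introT eqP (cards1 t)) cut0.
have {minU}minU t' U' : cuts S [set t'] U' -> #|U| <= #|U'|.
  by apply: minU; rewrite cards1.
have connU : connected U by apply: minimal_cut_connected cutU _ => U'; apply: minU.
have /cutsP[US U0 dUt SUt cl] := cutU.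
have tU : t \notin U by rewrite (disjointFl dUt) ?set11.
have [|y [w [yU wS wU yw]]] := connected_cut connS US U0.
  by apply: contraNneq SUt => <-; apply: subsetUl.
have wt : w = t.
  by apply/set1P; have := cl y w yU wS yw; rewrite (negbTE wU).
subst w; pose D := t |: U.
have DS : D \subset S by rewrite subUset sub1set wS.
have [||x [u [xD uS uD xu]]] := connected_cut connS DS.
- by apply/set0Pn; exists t; rewrite setU11.
- by apply: contraNneq SUt => <-; rewrite setUC.
have xt : x = t.
  move: xD; rewrite in_setU1 => /orP[/eqP //|xU].
  move: uD; rewrite in_setU1 negb_or => /andP[ut uU].
  by have := cl x u xU uS xu; rewrite (negbTE uU) inE (negbTE ut).
subst x; apply: (@brooks_core S D t y u) => //.
- by rewrite inE yU orbT.
- by rewrite adjC.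
- by move=> w wS' yw'; have := cl y w yU wS' yw'; rewrite in_setU1 orbC inE.
have ty : t != y by apply: contraNneq tU => ->.
apply: contraT => /(@connected_split _ _ adjC _ t)[|Z [ZD Z0 tZ clZ]].
  by rewrite !inE eqxx ty.
have ZU : Z \subset U :\ y.
  apply/subsetP=> v vZ; have := subsetP ZD v vZ.
  rewrite !inE; case: eqP => // _ /=; case: (altP (v =P t)) => // vt.
  by rewrite -vt vZ in tZ.
have ltZU : #|Z| < #|U|.
  by apply: leq_ltn_trans (subset_leq_card ZU) _; rewrite [X in _ < X](cardsD1 y) yU.
suff /minU : cuts S [set y] Z by rewrite leqNgt ltZU.
apply/cutsP; split=> //.
- by apply: subset_trans US; apply: subset_trans ZU (subsetDl _ _).
- by rewrite disjoint_sym disjoints1; apply/negP=> /(subsetP ZU); rewrite !inE eqxx.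
- by apply/subsetPn; exists t; rewrite // !inE negb_or tZ ty.
move=> v z vZ zS vz; rewrite inE; have [//|zZ /=] := boolP (z \in Z).
apply: contraT => zy.
have vU : v \in U by move: (subsetP ZU v vZ); rewrite inE => /andP[].
suff zD : z \in D :\ y by have := clZ v z vZ zD zZ; rewrite vz.
rewrite !inE zy /=.
by have := cl v z vU zS vz; rewrite orbC inE.
Qed.

(** Cut off as small a part U as possible by two vertices p and q. Both sides
contain a neighbour of p, say d in U and d' on the other side. By minimality of
U and as there is no cut vertex, the removal of d and d' does not disconnect S,
and d and d' can be given the same colour, which spares a colour for p. *)
Lemma brooks_two_cut (S F U : {set V}) :
  2 < #|C| -> connected S -> (forall v, v \in S -> #|nbrs S v| = #|C|) ->
  (forall t W, ~~ cuts S [set t] W) -> #|F| == 2 -> cuts S F U ->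
  exists c : V -> C, proper_on S c.
Proof.
move=> C2 connS degS no1 F2 cut0.
have [_ [{cut0 F F2}U [/cards2P[p [q [pq ->]]] cutU minU]]] :=
  @minimal_cut S (fun F => #|F| == 2) F U F2 cut0.
have {minU}minU p' q' U' : p' != q' -> cuts S [set p'; q'] U' -> #|U| <= #|U'|.
  by move=> pq'; apply: minU; rewrite cards2 pq'.
have /cutsP[US U0 dUF SUF cl] := cutU.
have pU : p \notin U by rewrite (disjointFl dUF) ?set21.
have qU : q \notin U by rewrite (disjointFl dUF) ?set22.
have W0 : exists2 w, w \in S & (w \notin U) && (w \notin [set p; q]).
  by have /subsetPn[w wS] := SUF; rewrite inE negb_or; exists w.
have [d [dU pS pd]] : exists d, [/\ d \in U, p \in S & adj p d].
  case: (boolP [exists d in U, (p \in S) && adj p d]).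
    by case/exists_inP=> d dU /andP[pS pd]; exists d.
  move=> nod; case/negP: (no1 q U); apply/cutsP; split=> //.
  - by rewrite disjoint_sym disjoints1.
  - by apply: contra SUF => /subset_trans; apply; rewrite setUS // sub1set set22.
  move=> u w uU wS uw; have := cl u w uU wS uw; rewrite !inE.
  case: eqP => // wp; case/exists_inP: nod; exists u => //.
  by rewrite -wp wS adjC.
have dS := subsetP US d dU.
have [d' [d'S d'U d'F pd']] :
    exists d', [/\ d' \in S, d' \notin U, d' \notin [set p; q] & adj p d'].
  pose W := S :\: (U :|: [set p; q]).
  case: (boolP [exists d in W, adj p d]).
    case/exists_inP=> d' /setDP[d'S]; rewrite inE negb_or => /andP[d'U d'F] pd'.
    by exists d'.
  move=> nod; case/negP: (no1 q W); apply/cutsP; split.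
  - exact: subsetDl.
  - case: W0 => w wS wUF; apply/set0Pn; exists w.
    by rewrite !inE negb_or -!in_set2 wS wUF.
  - by rewrite disjoint_sym disjoints1 !inE eqxx !orbT.
  - apply/subsetPn; exists d; rewrite // !inE dU /=.
    by apply: contraNneq qU => <-.
  move=> u w uW wS uw; rewrite !inE wS andbT !negb_or.
  move: (uW) => /setDP[uS]; rewrite inE negb_or => /andP[uU uF].
  case: (boolP (w \in U)) => [wU|wU /=].
    by have := cl w u wU uS; rewrite adjC uw (negbTE uU) (negbTE uF) => /(_ isT).
  case: (altP (w =P q)) => [|_]; rewrite ?orbT // andbT orbF.
  apply: contra nod => /eqP <-; apply/exists_inP; exists u => //.
  by rewrite adjC.
have dp : d != p by apply: contraTneq dU => ->.
have dq : d != q by apply: contraTneq dU => ->.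
have dd' : d != d' by apply: contraTneq dU => ->.
have d'p : d' != p by apply: contraNneq d'F => ->; rewrite set21.
have d'q : d' != q by apply: contraNneq d'F => ->; rewrite set22.
apply: (@brooks_core S (S :\ d') p d d') => //.
- by move=> v /degS ->.
- exact: subsetDl.
- by rewrite !inE eq_sym d'p.
- by rewrite !inE dd'.
- by rewrite !inE eqxx.
- move=> w wS dw; rewrite !inE wS andbT; apply: contraTneq dw => ->.
  by apply/negP=> /(cl d d' dU d'S); rewrite (negbTE d'U) (negbTE d'F).
rewrite (_ : S :\ d' :\ d = S :\: [set d; d']); last first.
  by apply/setP=> v; rewrite !inE negb_or andbA.
apply: contraT => /(@disconnected_cuts _ _ p pS)[|Z /cutsP[ZS Z0 dZF _ clZ] pZ].
  by rewrite !inE ![p == _]eq_sym negb_or dp.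
have dZ : d \notin Z by rewrite (disjointFl dZF) ?set21.
have d'Z : d' \notin Z by rewrite (disjointFl dZF) ?set22.
(* otherwise d and q would cut off the smaller part Z :&: U *)
have ZU0 : Z :&: U = set0.
  apply: contraTeq isT => ZU0.
  have ltZU : #|Z :&: U| < #|U|.
    apply/proper_card/properP; split; first exact: subsetIr.
    by exists d; rewrite // inE (negbTE dZ).
  suff /(minU d q _ dq) : cuts S [set d; q] (Z :&: U) by rewrite leqNgt ltZU.
  apply/cutsP; split=> //.
  - by apply: subset_trans US; apply: subsetIr.
  - rewrite -setI_eq0; apply/eqP/setP=> v; rewrite !inE; apply/negP.
    case/andP=> /andP[vZ vU] /orP[]/eqP vE; subst v.
      by rewrite vZ in dZ.
    by rewrite vU in qU.
  - by apply/subsetPn; exists p; rewrite // !inE (negbTE pZ) (eq_sym p d) (negbTE dp).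
  move=> u w /setIP[uZ uU] wS uw.
  have := clZ u w uZ wS uw; have := cl u w uU wS uw; rewrite !inE.
  case: (altP (w =P d)) => [->|wd]; rewrite ?orbT //=.
  case: (altP (w =P q)) => [->|wq]; rewrite ?orbT //=.
  case: (altP (w =P d')) => [->|wd']; first by rewrite (negbTE d'U) (negbTE d'p).
  case: (altP (w =P p)) => [->|wp]; first by rewrite (negbTE pZ).
  by rewrite !orbF => -> ->.
have notZU v : v \in Z -> v \in U -> False.
  by move=> vZ vU; have := in_set0 v; rewrite -ZU0 inE vZ vU.
(* otherwise d and p would cut off the smaller part U :\ d *)
have qZ : q \notin Z.
  apply/negP=> qZ; have qS := subsetP ZS q qZ.
  have Ud0 : U :\ d != set0.
    apply: contraTneq C2 => Ud; rewrite -leqNgt -(degS d dS).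
    have -> : 2 = #|[set p; q]| by rewrite cards2 pq.
    apply/subset_leq_card/subsetP=> w; rewrite in_nbrs => /andP[wS dw].
    have := cl d w dU wS dw; case: (boolP (w \in U)) => // wU _.
    have := in_set0 w; rewrite -Ud !inE wU andbT.
    by move/negbFE/eqP=> wd; rewrite wd adj_irr in dw.
  have ltU : #|U :\ d| < #|U| by rewrite [X in _ < X](cardsD1 d) dU.
  suff /(minU d p _ dp) : cuts S [set d; p] (U :\ d) by rewrite leqNgt ltU.
  apply/cutsP; split=> //.
  - by apply: subset_trans US; apply: subsetDl.
  - rewrite -setI_eq0; apply/eqP/setP=> v; rewrite !inE; apply/negP.
    case/andP=> /andP[vd vU] /orP[]/eqP vE; subst v.
      by rewrite eqxx in vd.
    by rewrite vU in pU.
  - apply/subsetPn; exists q; rewrite // !inE (negbTE qU) andbF.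
    by rewrite (eq_sym q d) (negbTE dq) (eq_sym q p) (negbTE pq).
  move=> u w; rewrite in_setD1 => /andP[ud uU] wS uw.
  have := cl u w uU wS uw; rewrite !inE.
  case: (altP (w =P d)) => [->|wd]; rewrite ?orbT //=.
  case: (altP (w =P p)) => [->|wp]; rewrite ?orbT //= orbF.
  case/orP=> [->//|/eqP wq]; subst w.
  have uS := subsetP US u uU.
  have := clZ q u qZ uS; rewrite adjC uw !inE (negbTE ud) => /(_ isT)/orP[uZ|/eqP ud'].
    by case: (notZU u).
  by rewrite -ud' uU in d'U.
(* what remains of Z is cut off by d' alone *)
case/negP: (no1 d' Z); apply/cutsP; split=> //.
- by rewrite disjoint_sym disjoints1.
- by apply/subsetPn; exists p; rewrite // !inE (negbTE pZ) (eq_sym p d') (negbTE d'p).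
move=> u w uZ wS uw; have := clZ u w uZ wS uw; rewrite !inE.
case: (altP (w =P d)) => //= wd; rewrite orbC => _; subst w.
have uS := subsetP ZS u uZ.
have := cl d u dU uS; rewrite adjC uw !inE => /(_ isT)/or3P[uU|/eqP up|/eqP uq].
- by case: (notZU u).
- by rewrite -up uZ in pZ.
- by rewrite -uq uZ in qZ.
Qed.

Lemma proper_glue (D : eqType) (S U : {set V}) (c1 c2 : V -> D) :
  (forall u w, u \in U -> w \in S -> w \notin U -> adj u w -> c1 u != c2 w) ->
  proper_on U c1 -> proper_on (S :\: U) c2 ->
  proper_on S (fun v => if v \in U then c1 v else c2 v).
Proof.
move=> cross c1P c2P u w uS wS uw.
case: (boolP (u \in U)) => uU; case: (boolP (w \in U)) => wU.
- exact: c1P.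
- exact: cross.
- by rewrite eq_sym cross // adjC.
- by apply: c2P; rewrite // inE ?uU ?wU.
Qed.

Definition list_colorable (L : V -> {set C}) (S : {set V}) :=
  exists2 c : V -> C, proper_on S c & forall v, v \in S -> c v \in L v.

(** For a hereditary property P, colourings of the two sides of a cut without
crossing edges can be put together, so only connected sets matter. *)
Lemma connected_suffices (x0 : C) (L : V -> {set C}) (P : {set V} -> Prop) :
  (forall S T : {set V}, T \subset S -> P S -> P T) ->
  (forall S, P S -> connected S -> S != set0 ->
     (forall T : {set V}, T \proper S -> list_colorable L T) ->
     list_colorable L S) ->
  forall S, P S -> list_colorable L S.
Proof.
move=> Psub Pconn S; have [n] := ubnP #|S|; elim: n S => // n IHn S leS PS.
have sub (T : {set V}) : T \proper S -> list_colorable L T.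
  move=> /[dup] /proper_card ltTS /proper_sub TS; apply: IHn; last exact: Psub PS.
  by move: leS; rewrite ltnS; apply: leq_trans.
have [->|S0] := eqVneq S set0.
  by exists (fun=> x0) => [u v|v]; rewrite inE.
have [connS|/connectedPn[U [US U0 UnS cl]]] := boolP (connected S).
  exact: Pconn.
have [|c1 c1P c1L] := sub U; first by rewrite properEneq UnS.
have [|c2 c2P c2L] := sub (S :\: U).
  case/set0Pn: U0 => u uU; apply/properP; split; first exact: subsetDl.
  by exists u; rewrite ?inE ?uU // (subsetP US).
eexists.
  apply: (proper_glue _ c1P c2P) => u w uU wS wU uw.
  by case/negP: (cl u w uU wS wU).
by move=> v vS /=; case: ifP => vU; [apply: c1L | apply: c2L; rewrite inE vU].
Qed.

Lemma slack_coloring (L : V -> {set C}) (S : {set V}) x :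
  connected S -> (forall v, v \in S -> #|nbrs S v| <= #|L v|) ->
  x \in S -> #|nbrs S x| < #|L x| -> list_colorable L S.
Proof.
move=> connS degS xS slack.
have x0 : C by suff /card_gt0P/sigW[] : 0 < #|L x| by []; apply: leq_trans slack.
have d0 : [disjoint set0 & S] by rewrite disjoints_subset sub0set.
have p0 : proper_on set0 (fun _ : V => x0) by move=> ? ?; rewrite inE.
have [v vS _||c [cP _ cL]] :=
    @greedy_root _ _ adjC adj_irr C L set0 S x _ connS xS p0 d0.
- by rewrite set0U degS.
- rewrite (_ : nbrs set0 x = set0) ?imset0 ?set0I ?cards0 //.
  by apply/setP=> v; rewrite !inE.
by exists c; rewrite // set0U in cP.
Qed.

(** If there are neither cut vertices nor cut pairs, any two nonadjacent
neighbours y and u of some vertex will do in [brooks_core], and a regular graph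
that is not complete has such y and u. *)
Theorem brooks (S : {set V}) :
  2 < #|C| -> (forall v, v \in S -> #|nbrs S v| <= #|C|) ->
  (forall K : {set V}, K \subset S -> #|K| = #|C|.+1 -> ~~ clique adj K) ->
  exists c : V -> C, proper_on S c.
Proof.
move=> C2 degS noK.
have x0 : C by suff /card_gt0P/sigW[] : 0 < #|C| by []; apply: leq_trans C2.
suff [c cP _] : list_colorable (fun=> setT) S by exists c.
move: S {degS noK}(conj degS noK); apply: (connected_suffices x0).
  move=> S T TS [degS noK]; split=> [v vT|K KT].
    by apply: leq_trans (degS v (subsetP TS v vT)); apply/subset_leq_card/nbrs_sub.
  by apply: noK; apply: subset_trans TS.
move=> S [degS noK] connS /set0Pn[v0 v0S] _.
suff [c cP] : exists c : V -> C, proper_on S c by exists c.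
have [|reg] := boolP [exists v in S, #|nbrs S v| < #|C|].
  case/exists_inP=> v vS slack.
  have [||c cP _] := @slack_coloring (fun=> setT) S v connS _ vS; last by exists c.
    by move=> u uS; rewrite cardsT degS.
  by rewrite cardsT.
have {}reg v : v \in S -> #|nbrs S v| = #|C|.
  move=> vS; apply/eqP; rewrite eqn_leq degS //= leqNgt.
  by apply: contra reg => ltv; apply/exists_inP; exists v.
have [|no1] := boolP [exists t, exists U, cuts S [set t] U].
  by case/existsP=> t /existsP[U cutU]; apply: brooks_cut_vertex cutU.
have {}no1 t U : ~~ cuts S [set t] U.
  by apply: contra no1 => cutU; apply/existsP; exists t; apply/existsP; exists U.
have [|no2] := boolP [exists F : {set V}, (#|F| == 2) && [exists U, cuts S F U]].
  by case/existsP=> F /andP[F2 /existsP[U cutU]]; apply: brooks_two_cut cutU.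
(* v0 and its neighbours do not form a clique, which yields y and u *)
have v0K : v0 \notin nbrs S v0 by rewrite in_nbrs adj_irr andbF.
have := noK (v0 |: nbrs S v0); rewrite subUset sub1set v0S.
rewrite (subset_trans _ (subxx S)); last by apply/subsetP=> v; rewrite in_nbrs => /andP[].
rewrite cardsU1 v0K add1n reg // => /(_ isT erefl).
case/forall_inPn=> y yK /forall_inPn[u uK]; rewrite negb_imply => /andP[yu nyu].
have nbK w : w \in v0 |: nbrs S v0 -> w != v0 -> (w \in S) && adj v0 w.
  by rewrite !inE => /orP[->|].
have yv0 : y != v0.
  apply: contra nyu => /eqP yv; move: yu; rewrite yv eq_sym => /(nbK _ uK).
  by case/andP.
have uv0 : u != v0.
  apply: contra nyu => /eqP uv; move: yu; rewrite uv => /(nbK _ yK).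
  by rewrite adjC => /andP[].
have /andP[yS v0y] := nbK y yK yv0; have /andP[uS v0u] := nbK u uK uv0.
apply: (@brooks_core S (S :\ u) v0 y u) => //.
- exact: subsetDl.
- by rewrite !inE eq_sym uv0.
- by rewrite !inE yu.
- by rewrite !inE eqxx.
- by move=> w wS yw; rewrite !inE wS andbT; apply: contraTneq yw => ->.
rewrite (_ : S :\ u :\ y = S :\: [set y; u]); last first.
  by apply/setP=> v; rewrite !inE negb_or andbA.
apply: contraT => /(@disconnected_cuts _ _ v0 v0S)[|Z cutZ _].
  by rewrite !inE ![v0 == _]eq_sym negb_or yv0.
case/existsP: no2; exists [set y; u]; rewrite cards2 yu.
by apply/existsP; exists Z.
Qed.

End Brooks.

(** * Unions of matchings *)

Lemma card_involution (V : finType) (f : V -> V) (K : {set V}) :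
  involutive f -> (forall v, v \in K -> f v \in K) ->
  (forall v, v \in K -> f v != v) -> ~~ odd #|K|.
Proof.
move=> fK; have [n] := ubnP #|K|; elim: n K => // n IHn K leK Kf nofix.
have [->|/set0Pn[v vK]] := eqVneq K set0; first by rewrite cards0.
have fvK : f v \in K :\ v by rewrite !inE nofix ?Kf.
rewrite (cardsD1 v) vK (cardsD1 (f v)) fvK /= negbK; apply: IHn.
- by move: leK; rewrite (cardsD1 v) vK (cardsD1 (f v)) fvK ltnS; apply: ltnW.
- move=> w; rewrite !inE => /and3P[wfv wv wK].
  rewrite Kf // andbT (inj_eq (inv_inj fK)) wv /=.
  by apply: contraNneq wfv => <-; rewrite fK.
by move=> w; rewrite !inE => /and3P[_ _]; apply: nofix.
Qed.

Section Matchings.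
Variables (V : finType) (adj : rel V).
Hypotheses (adjC : symmetric adj) (adj_irr : irreflexive adj).
Variables (I : finType) (f : I -> V -> V).
Hypothesis fK : forall i, involutive (f i).
Notation nbrs := (nbrs adj).
Notation connected := (connected adj).
Notation proper_on := (proper_on adj).

(** Matchings are given as involutions [f i], whose fixed points are the
unmatched vertices. *)
Definition matched_on (S : {set V}) :=
  {in S &, forall u v, adj u v -> exists i, f i u = v}.

Lemma matched_sub (S T : {set V}) : T \subset S -> matched_on S -> matched_on T.
Proof. by move=> TS mS u v /(subsetP TS) uS /(subsetP TS); apply: mS. Qed.

Lemma matched_nbrs (S : {set V}) v : matched_on S -> v \in S ->
  nbrs S v \subset [set f i v | i in I].
Proof.
move=> mS vS; apply/subsetP=> u; rewrite in_nbrs => /andP[uS vu].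
by have [i <-] := mS v u vS uS vu; apply: imset_f.
Qed.

Lemma matched_degree (S : {set V}) v : matched_on S -> v \in S ->
  #|nbrs S v| <= #|I|.
Proof.
move=> mS vS.
exact: leq_trans (subset_leq_card (matched_nbrs mS vS)) (leq_imset_card _ _).
Qed.

Lemma matched_full (S : {set V}) v : matched_on S -> v \in S ->
  #|I| <= #|nbrs S v| ->
  (forall i, f i v \in nbrs S v) /\ injective (fun i => f i v).
Proof.
move=> mS vS full; have sub := matched_nbrs mS vS.
have le := leq_imset_card (fun i => f i v) I.
have eqN : nbrs S v = [set f i v | i in I].
  by apply/eqP; rewrite eqEcard sub (leq_trans le full).
split=> [i|]; first by rewrite eqN imset_f.
have /imset_injP inj : #|[set f i v | i in I]| == #|I|.
  by rewrite eqn_leq le -eqN.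
by move=> i j; apply: inj.
Qed.

Variable C : finType.

(** When every vertex of S is matched twice, colour greedily all vertices but
one, x. Each matching pairs off the two colours on S :\ x, except that the
partner of x is left over; so the colour of that partner is the more frequent
colour on S :\ x, whichever matching is used, and the other one is free for
x. *)
Lemma two_matchings_coloring (S : {set V}) :
  #|I| <= 2 -> #|C| = 2 -> matched_on S -> exists c : V -> C, proper_on S c.
Proof.
move=> I2 C2 mS.
have x0 : C by suff /card_gt0P/sigW[] : 0 < #|C| by []; rewrite C2.
suff [c cP _] : list_colorable adj (fun=> [set: C]) S by exists c.
move: S mS; apply: (connected_suffices adjC x0).
  by move=> S T; apply: matched_sub.
move=> S mS connS /set0Pn[x xS] _.
have deg2 v : v \in S -> #|nbrs S v| <= #|[set: C]|.
  by move=> vS; rewrite cardsT C2; apply: leq_trans I2; apply: matched_degree.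
have [/exists_inP[v vS slack]|reg] := boolP [exists v in S, #|nbrs S v| < 2].
  by apply: (slack_coloring adjC adj_irr connS deg2 vS); rewrite cardsT C2.
have full v : v \in S -> (forall i, f i v \in nbrs S v) /\ injective (fun i => f i v).
  move=> vS; apply: matched_full => //; apply: leq_trans I2 _.
  by rewrite leqNgt; apply: contra reg => ltv; apply/exists_inP; exists v.
have fS i v : v \in S -> f i v \in S /\ adj v (f i v).
  by move=> /full[/(_ i) + _]; rewrite in_nbrs => /andP.
have d0 : [disjoint set0 & S] by rewrite disjoints_subset sub0set.
have p0 : proper_on set0 (fun _ : V => x0) by move=> ? ?; rewrite inE.
have [||v|c [cP _ _]] :=
  @greedy _ _ adjC adj_irr C (fun=> setT) set0 S [set x] _ connS _ _ p0 d0.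
- by rewrite sub1set.
- by apply/set0Pn; exists x; rewrite set11.
- by move=> /setDP[vS _]; rewrite set0U deg2.
rewrite set0U in cP.
pose class a := [set v in S :\ x | c v == a].
(* the partners under f i of the vertices of colour b all have the colour of
   f i x, and f i x is not one of them, as its partner x is uncoloured *)
have ltclass i b : b != c (f i x) -> #|class b| < #|class (c (f i x))|.
  move=> bc; have [fxS xfx] := fS i x xS.
  have fxx : f i x != x by apply: contraTneq xfx => ->; rewrite adj_irr.
  rewrite -(card_imset _ (inv_inj (fK i))).
  apply/proper_card/properP; split; last first.
    exists (f i x); first by rewrite !inE fxx fxS eqxx.
    by rewrite (mem_imset _ _ (inv_inj (fK i))) !inE eqxx.
  apply/subsetP=> _ /imsetP[v + ->]; rewrite !inE => /andP[/andP[vx vS] /eqP cv].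
  have [fvS vfv] := fS i v vS.
  have fvx : f i v != x.
    by apply: contraNneq bc => <-; rewrite fK cv.
  rewrite fvx fvS /=.
  have := cP v (f i v); rewrite !inE vx vS fvx fvS vfv cv => /(_ isT isT isT) bfv.
  have two : [set: C] = [set b; c (f i x)].
    by apply/esym/eqP; rewrite eqEcard subsetT cardsT C2 cards2 bc.
  have := in_setT (c (f i v)); rewrite two !inE => /orP[/eqP bE|//].
  by rewrite bE eqxx in bfv.
have mono i j : c (f i x) = c (f j x).
  apply: contraTeq isT => cij.
  by have := ltn_trans (ltclass j _ cij) (ltclass i _ _); rewrite ltnn eq_sym => /(_ cij).
have [|a _ aP] := @free_color _ [set: C] (c @: nbrs S x).
  rewrite setIT cardsT C2.
  have [->|/set0Pn[y yx]] := eqVneq (nbrs S x) set0; first by rewrite imset0 cards0.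
  rewrite (_ : c @: _ = [set c y]) ?cards1 //; apply/setP=> b; rewrite inE.
  apply/imsetP/eqP=> [[z zx ->]|->]; last by exists y.
  have /imsetP[i _ ->] := subsetP (matched_nbrs mS xS) z zx.
  by have /imsetP[j _ ->] := subsetP (matched_nbrs mS xS) y yx.
exists [eta c with x |-> a] => [|v vS]; last by rewrite inE.
rewrite -(setD1K xS); apply: proper_extend; rewrite ?adj_irr //.
move=> u ux; apply: contraNneq aP => <-; apply: imset_f.
by apply: subsetP ux; apply/nbrs_sub/subsetDl.
Qed.

(** By parity, no clique on an odd number #|C| + 1 of vertices can be perfectly
matched, whereas every vertex of such a clique would use all the matchings. *)
Lemma even_matchings_coloring (S : {set V}) :
  #|I| <= #|C| -> 0 < #|C| -> ~~ odd #|C| -> matched_on S ->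
  exists c : V -> C, proper_on S c.
Proof.
move=> IC C0 Ceven mS; have [C2|C2] := ltnP 2 #|C|; last first.
  have C2' : #|C| = 2 by move: C0 C2 Ceven; case: #|C| => [|[|[]]].
  by apply: two_matchings_coloring; rewrite -?C2'.
apply: brooks => // [v vS|K KS cardK].
  by apply: leq_trans IC; apply: matched_degree.
apply/negP=> /cliqueP Kcl.
have mK := matched_sub KS mS.
have full v : v \in K -> (forall i, f i v \in nbrs K v) /\ injective (fun i => f i v).
  move=> vK; apply: matched_full => //; apply: leq_trans IC _.
  rewrite -ltnS -cardK (cardsD1 v) vK add1n ltnS; apply: subset_leq_card.
  by apply/subsetP=> u; rewrite !inE => /andP[uv uK]; rewrite uK Kcl // eq_sym.
have [v vK] : exists v, v \in K by apply/card_gt0P; rewrite cardK.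
have IC' : 0 < #|I|.
  suff : 0 < #|nbrs K v| by move/leq_trans; apply; apply: matched_degree.
  apply: leq_trans (_ : #|K :\ v| <= _); last first.
    apply: subset_leq_card; apply/subsetP=> u; rewrite !inE => /andP[uv uK].
    by rewrite uK Kcl // eq_sym.
  by move: cardK; rewrite (cardsD1 v) vK add1n => -[->].
have [i _] := card_gt0P IC'.
suff : ~~ odd #|K| by rewrite cardK /= Ceven.
by apply: (card_involution (fK i)) => w /full[/(_ i)]; rewrite in_nbrs => /andP[//];
  move=> _ wf _; apply: contraTneq wf => ->; rewrite adj_irr.
Qed.
End Matchings.

(** * Colourings in which the colour 0 avoids a given set *)

Section Avoid.
Variables (V : finType) (adj : rel V).
Hypotheses (adjC : symmetric adj) (adj_irr : irreflexive adj).
Notation nbrs := (nbrs adj).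
Notation connected := (connected adj).
Notation proper_on := (proper_on adj).
Notation cuts := (cuts adj).

Lemma connected_mono (U Y : {set V}) : connected U ->
  {in U &, forall x y, x \notin Y -> y \in Y -> ~~ adj x y} ->
  U \subset Y \/ [disjoint U & Y].
Proof.
move=> connU noXY; have [|nUY] := boolP [disjoint U & Y]; first by right.
left; have [//|UY] := eqVneq (U :&: Y) U; first by move/setIidPl.
have [|u [w [/setIP[uU uY] wU wnUY uw]]] := connected_cut connU (subsetIl U Y) _ UY.
  by rewrite setI_eq0.
rewrite inE wU /= in wnUY.
by have := noXY w u wU uU wnUY uY; rewrite adjC uw.
Qed.

Variables (k : nat) (Y : {set V}).
Definition avoid_list (v : V) : {set 'I_k.+1} := if v \in Y then [set~ ord0] else setT.
Notation L := avoid_list.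

Lemma avoid_list_mem v a : (a \in avoid_list v) = (v \in Y) ==> (a != ord0).
Proof. by rewrite /avoid_list; case: (v \in Y); rewrite !inE. Qed.

Lemma avoid_list_card v : #|L v| = (v \notin Y) + k.
Proof.
rewrite /avoid_list; case: (v \in Y); last by rewrite cardsT card_ord.
by rewrite cardsC1 card_ord.
Qed.

(** The third condition is where parity enters: in the application, the edges
inside such a B are covered by an even number k of matchings. *)
Definition admissible (S : {set V}) :=
  [/\ forall v, v \in S -> #|nbrs S v| <= (v \notin Y) + k,
      forall K : {set V}, K \subset S -> #|K| = k.+2 -> ~~ clique adj K
    & forall B : {set V}, B \subset S -> #|B :\: Y| <= 1 ->
        exists c : V -> 'I_k, proper_on B c].

Hypothesis k2 : 1 < k.

Lemma admissible_sub (S T : {set V}) : T \subset S -> admissible S -> admissible T.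
Proof.
move=> TS [degS noK smallS]; split=> [v vT|K KT|B BT].
- by apply: leq_trans (degS v (subsetP TS v vT)); apply/subset_leq_card/nbrs_sub.
- by apply: noK; apply: subset_trans TS.
- by apply: smallS; apply: subset_trans TS.
Qed.

Lemma admissible_nonzero (S : {set V}) : admissible S -> #|S :\: Y| <= 1 ->
  exists2 c : V -> 'I_k.+1, proper_on S c & forall v, c v != ord0.
Proof.
case=> _ _ small SY; have [c cP] := small S (subxx S) SY.
exists (fun v => lift ord0 (c v)) => [u v uS vS uv|v]; last by rewrite eq_sym neq_lift.
by rewrite (inj_eq lift_inj); apply: cP.
Qed.

Lemma admissible_brooks (S : {set V}) : admissible S ->
  exists c : V -> 'I_k.+1, proper_on S c.
Proof.
case=> degS noK _; apply: brooks; rewrite ?card_ord // => v vS.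
by apply: leq_trans (degS v vS) _; rewrite -add1n leq_add2r leq_b1.
Qed.

(** The two sides of a cut vertex x are coloured independently; exchanging two
colours on one side makes the colourings agree at x. *)
Lemma admissible_glue (S U : {set V}) x (c1 c2 : V -> 'I_k.+1) :
  cuts S [set x] U -> proper_on (S :\: U) c1 ->
  (forall v, v \in S :\: U -> c1 v \in L v) -> proper_on (x |: U) c2 ->
  (forall u, u \in U -> tperm (c2 x) (c1 x) (c2 u) \in L u) ->
  list_colorable adj L S.
Proof.
move=> /cutsP[US _ _ _ cl] c1P c1L c2P c2L.
exists (fun v => if v \in U then tperm (c2 x) (c1 x) (c2 v) else c1 v).
  apply: (proper_glue adjC _ _ c1P) => [u w uU wS wU uw|u w uU wU uw].
    have /set1P wx : w \in [set x].
      by have := cl u w uU wS uw; rewrite (negbTE wU).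
    subst w; rewrite -[c1 x in X in _ != X](tpermL (c2 x)) (inj_eq perm_inj).
    by apply: c2P; rewrite // !inE ?uU ?eqxx ?orbT.
  by rewrite (inj_eq perm_inj); apply: c2P; rewrite // inE ?uU ?wU orbT.
move=> v vS /=; case: ifP => vU; first exact: c2L.
by apply: c1L; rewrite inE vU.
Qed.

(** Give the colour 0 to x and colour the rest towards y, to which the colour 0
of its neighbour x was forbidden anyway. *)
Lemma admissible_interface (S : {set V}) x y : admissible S ->
  connected (S :\ x) -> x \in S -> y \in S -> x \notin Y -> y \in Y ->
  adj x y -> list_colorable adj L S.
Proof.
move=> [degS _ _] connSx xS yS xY yY xy.
have yx : y != x by apply: contraNneq xY => <-.
have ySx : y \in S :\ x by rewrite !inE yx.
have p1 : proper_on [set x] (fun _ : V => @ord0 k).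
  by move=> u v /set1P-> /set1P->; rewrite adj_irr.
have dx : [disjoint [set x] & S :\ x] by rewrite disjoints1 !inE eqxx.
have [v||c [cP c0 cL]] := @greedy_root _ _ adjC adj_irr _ L _ _ y _ connSx ySx p1 dx.
- by move=> /setD1P[_ vS] _; rewrite setD1K // avoid_list_card degS.
- rewrite (_ : _ :&: _ = set0) ?cards0 ?add0n; last first.
    apply/setP=> a; rewrite !inE avoid_list_mem yY /=; apply/negP=> /andP[].
    by case/imsetP=> v _ ->; rewrite eqxx.
  rewrite avoid_list_card; apply: leq_trans (degS y yS); apply: proper_card.
  apply/properP; split; first by apply/nbrs_sub/subsetDl.
  by exists x; rewrite !inE ?eqxx // xS adjC.
rewrite setD1K // in cP; exists c => // v vS.
have [->|vx] := eqVneq v x; first by rewrite avoid_list_mem (negbTE xY).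
by apply: cL; rewrite !inE vx.
Qed.

(** If S meets both Y and its complement, some x outside Y is adjacent to a
vertex of Y. Unless [admissible_interface] applies, every such x is a cut
vertex, and cuts off some U; choose x and U so that U is as small as possible.
Then U is inside Y or disjoint from Y, as an x' in U of the same kind would cut
off a smaller part. If U is disjoint from Y, any colouring of x |: U can be
glued to one of the rest. If U is inside Y, colour the rest of S first: if x
got the colour 0, colour U greedily towards a neighbour of x, and otherwise glue
a colouring of x |: U without the colour 0. *)
Lemma admissible_coloring (S : {set V}) : admissible S -> list_colorable adj L S.
Proof.
move: S; apply: (connected_suffices adjC ord0); first exact: admissible_sub.
move=> S admS connS S0 IH; have [degS noK small] := admS.
pose interface x := [&& x \in S, x \notin Y & [exists y in S, (y \in Y) && adj x y]].
have [/existsP[x0 x0I]|noI] := boolP [exists x, interface x]; last first.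
  have [|SY|dSY] := connected_mono (Y := Y) connS.
  - move=> x y xS yS xY yY; apply: contra noI => xy; apply/existsP; exists x.
    by rewrite /interface xS xY; apply/exists_inP; exists y; rewrite ?yY.
  - have [|c cP c0] := admissible_nonzero admS.
      by rewrite (eqP (_ : S :\: Y == set0)) ?cards0 // setD_eq0.
    by exists c => // v _; rewrite avoid_list_mem c0 implybT.
  - have [c cP] := admissible_brooks admS.
    by exists c => // v vS; rewrite avoid_list_mem (disjointFr dSY).
have [[x [y [xI [yS yY] xy connSx]]]|disc] :
    (exists x y, [/\ interface x, y \in S /\ y \in Y, adj x y & connected (S :\ x)])
    \/ forall x, interface x -> ~~ connected (S :\ x).
- have [/existsP[x /andP[xI connSx]]|noconn] :=
    boolP [exists x, interface x && connected (S :\ x)].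
    left; have /and3P[_ _ /exists_inP[y yS /andP[yY xy]]] := xI.
    by exists x, y.
  right=> x xI; apply: contra noconn => connSx.
  by apply/existsP; exists x; rewrite xI.
- have /and3P[xS xY _] := xI.
  exact: (@admissible_interface S x y).
have [U0 cut0] : exists U0, cuts S [set x0] U0.
  have /and3P[x0S x0Y /exists_inP[y yS /andP[yY _]]] := x0I.
  have [|Z cutZ _] := disconnected_cuts adjC (x := y) yS _ (disc x0 x0I).
    by rewrite inE; apply: contraNneq x0Y => <-.
  by exists Z.
have [|_ [U [/existsP[x /andP[/eqP-> xI]] cutU minU]]] :=
    @minimal_cut _ adj S (fun F => [exists x, (F == [set x]) && interface x])
       [set x0] U0 _ cut0.
  by apply/existsP; exists x0; rewrite eqxx.
have {}minU x' U' : interface x' -> cuts S [set x'] U' -> #|U| <= #|U'|.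
  by move=> x'I; apply: minU; apply/existsP; exists x'; rewrite eqxx.
have connU : connected U by apply: minimal_cut_connected cutU _ => U'; apply: minU.
have /cutsP[US Un0 dUx SUx cl] := cutU.
have xU : x \notin U by rewrite (disjointFl dUx) ?set11.
have /and3P[xS xY _] := xI.
have [|z [w [zU wS wU zw]]] := connected_cut connS US Un0.
  by apply: contraNneq SUx => <-; apply: subsetUl.
have /set1P wx : w \in [set x] by have := cl z w zU wS zw; rewrite (negbTE wU).
subst w; clear wS wU.
have ltSU : S :\: U \proper S.
  by apply/properP; split; [exact: subsetDl | exists z; rewrite ?(subsetP US) // inE zU].
have [c1 c1P c1L] := IH _ ltSU.
have xUS : x |: U \subset S by rewrite subUset sub1set xS.
have admU := admissible_sub xUS admS.
have [|UY|dUY] := connected_mono (Y := Y) connU; last first.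
- have [c2 c2P] := admissible_brooks admU.
  apply: (admissible_glue cutU c1P c1L c2P) => u uU.
  by rewrite avoid_list_mem (disjointFr dUY).
- have [c1x|c1x] := eqVneq (c1 x) ord0; last first.
    have [|c2 c2P c2n0] := admissible_nonzero admU.
      rewrite setDUl (eqP (_ : U :\: Y == set0)) ?setD_eq0 // setU0.
      by apply: leq_trans (subset_leq_card (subsetDl _ _)) _; rewrite cards1.
    apply: (admissible_glue cutU c1P c1L c2P) => u uU.
    rewrite avoid_list_mem; apply/implyP=> _.
    by case: tpermP => // _; apply: c2n0.
  have dSU : [disjoint S :\: U & U].
    by rewrite -setI_eq0 setDE -setIA [~: U :&: U]setIC setICr setI0.
  have SUU : S :\: U :|: U = S.
    apply/setP=> v; rewrite !inE.
    by case: (boolP (v \in U)) => [/(subsetP US)->|]; rewrite ?orbT ?orbF.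
  have [v||c [cP cc1 cL]] :=
    @greedy_root _ _ adjC adj_irr _ L (S :\: U) U z c1 connU zU c1P dSU.
  + by move=> vU _; rewrite SUU avoid_list_card degS // (subsetP US).
  + have zY := subsetP UY z zU.
    rewrite (_ : _ :&: _ = set0) ?cards0 ?add0n; last first.
      apply/setP=> a; rewrite in_set0 in_setI avoid_list_mem zY /=; apply/negP=> /andP[].
      case/imsetP=> v; rewrite !inE => /andP[/andP[vU vS] zv] ->.
      have := cl z v zU vS zv; rewrite (negbTE vU) inE => /eqP->.
      by rewrite c1x eqxx.
    rewrite avoid_list_card; apply: leq_trans (degS z (subsetP US z zU)).
    apply: proper_card; apply/properP; split; first exact: nbrs_sub.
    by exists x; rewrite !inE ?xS ?(negbTE xU).
  rewrite SUU in cP; exists c => // v vS.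
  have [vU|vU] := boolP (v \in U); first exact: cL.
  by have vSU : v \in S :\: U; [rewrite inE vU | rewrite cc1 ?c1L].
(* U cannot meet both Y and its complement: its minimality is contradicted by
   the part Z that x' separates from x *)
move=> x' y' x'U y'U x'Y y'Y; apply/negP=> xy'.
have x'S := subsetP US x' x'U.
have x'I : interface x'.
  rewrite /interface x'S x'Y; apply/exists_inP.
  by exists y'; rewrite ?(subsetP US) // y'Y.
have xx' : x != x' by apply: contraNneq xU => ->.
have [|Z /cutsP[ZS Z0 dZ SZ clZ] xZ] := disconnected_cuts adjC xS _ (disc x' x'I).
  by rewrite inE.
have x'Z : x' \notin Z by rewrite (disjointFl dZ) ?set11.
have [ZU0|ZU] := eqVneq (Z :&: U) set0.
  have /cutsP[] := connected_cuts0 Z connS; split=> //.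
  - by rewrite -setI_eq0 setI0.
  - by apply/subsetPn; exists x; rewrite // !inE orbF.
  move=> u w uZ wS uw; have := clZ u w uZ wS uw; rewrite !inE.
  case: (w \in Z) => //= /eqP wx'; subst w.
  have := cl x' u x'U (subsetP ZS u uZ); rewrite adjC uw => /(_ isT)/orP[uU|/set1P ux].
    by have := in_set0 u; rewrite -ZU0 inE uZ uU.
  by rewrite -ux uZ in xZ.
have ltZU : #|Z :&: U| < #|U|.
  apply/proper_card/properP; split; first exact: subsetIr.
  by exists x'; rewrite // inE (negbTE x'Z).
suff /(minU x' _ x'I) : cuts S [set x'] (Z :&: U) by rewrite leqNgt ltZU.
apply/cutsP; split=> //.
- by apply: subset_trans US; apply: subsetIr.
- by apply: disjointWl dZ; apply: subsetIl.
- by apply: contra SZ => /subset_trans; apply; apply/setSU/subsetIl.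
move=> u w /setIP[uZ uU] wS uw.
have := clZ u w uZ wS uw; have := cl u w uU wS uw; rewrite !inE.
case: (altP (w =P x')) => [->|_]; rewrite ?orbT ?orbF //.
by case: (altP (w =P x)) => [->|_]; rewrite ?(negbTE xZ) ?orbF // => -> ->.
Qed.

End Avoid.

(** * A matching meeting all triples of a class *)

Section Patch.
Variable V : finType.
Implicit Types (D e h : {set V}) (f g : V -> V).

Definition patch D g f v := if v \in D then g v else f v.

Lemma patchK D g f :
  involutive g -> involutive f -> (forall v, v \in D -> g v \in D) ->
  (forall v, v \in D -> f v \in D) -> involutive (patch D g f).
Proof.
move=> gK fK gD fD v; rewrite /patch; case: (boolP (v \in D)) => [/gD->|vD].
  exact: gK.
by case: ifP => [/fD|_]; rewrite fK // (negbTE vD).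
Qed.

Definition swap4 (a b c d v : V) := tperm a b (tperm c d v).

Lemma swap4P (a b c d : V) : uniq [:: a; b; c; d] ->
  [/\ involutive (swap4 a b c d),
      swap4 a b c d a = b, swap4 a b c d b = a,
      swap4 a b c d c = d & swap4 a b c d d = c].
Proof.
rewrite /= !inE !negb_or => /and4P[/and3P[ab ac ad] /andP[bc bd] cd _].
have E : [/\ swap4 a b c d a = b, swap4 a b c d b = a,
      swap4 a b c d c = d & swap4 a b c d d = c].
  rewrite /swap4 tpermL tpermR !(tpermD (x := c) (y := d)) 1?eq_sym //.
  by rewrite tpermL tpermR !tpermD.
have [Ea Eb Ec Ed] := E; split=> // v.
have [->|va] := eqVneq v a; first by rewrite Ea.
have [->|vb] := eqVneq v b; first by rewrite Eb.
have [->|vc] := eqVneq v c; first by rewrite Ec.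
have [->|vd] := eqVneq v d; first by rewrite Ed.
by rewrite /swap4 !tpermD // eq_sym.
Qed.

Definition pairs f e := [exists u in e, (f u \in e) && (f u != u)].

Lemma pairsP f e : reflect (exists u, [/\ u \in e, f u \in e & f u != u]) (pairs f e).
Proof.
apply: (iffP exists_inP) => [[u ue /andP[]]|[u [ue fu nfu]]]; first by exists u.
by exists u; rewrite // fu.
Qed.

(** A triple misses only one point d of a four-element set that is perfectly
matched, so it contains every matched pair but that of d. *)
Lemma pairs_in_four D e f : #|D| = 4 -> #|e| = 3 -> e \subset D ->
  injective f -> (forall v, v \in D -> f v \in D) ->
  (forall v, v \in D -> f v != v) -> pairs f e.
Proof.
move=> D4 e3 eD f_inj fD nofix.
have /cards1P[d dE] : #|D :\: e| == 1 by rewrite cardsD (setIidPr eD) D4 e3.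
have [u ue fud] : exists2 u, u \in e & f u != d.
  have /card_gt1P[u [v [ue ve uv]]] : 1 < #|e| by rewrite e3.
  case: (altP (f u =P d)) => [fu|]; last by exists u.
  by exists v; rewrite // -fu (inj_eq f_inj) eq_sym.
have uD := subsetP eD u ue.
apply/pairsP; exists u; split; rewrite ?nofix //.
by apply: contraR fud => fue; rewrite -in_set1 -dE inE fue fD.
Qed.

End Patch.

Section Intersecting.
Variable V : finType.
Implicit Types (D e h : {set V}) (f g : V -> V) (F B : {set {set V}}).

(** Let e0 and e1 be two of the triples, P their intersection and D their union.
A triple with a point z outside D meets e0 and e1 in its two other points, which
therefore form P. So if there is a triple e2 not containing P, every triple is
inside D: one with a point outside D would meet e2 only inside P. *)
Lemma intersecting_pairing B e0 : e0 \in B ->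
  {in B, forall e, #|e| = 3} -> {in B &, forall e h, 1 < #|e :&: h|} ->
  exists D g, [/\ D \subset cover B, involutive g,
    forall v, v \in D -> g v \in D, forall v, v \in D -> g v != v
    & forall e, e \in B -> exists u, [/\ u \in e, u \in D & g u \in e]].
Proof.
move=> e0B B3 BI.
have sub e : e \in B -> e \subset cover B by move=> eB; apply: bigcup_sup.
have [/existsP[a /existsP[b /andP[ab /forall_inP ker]]]|noker] :=
  boolP [exists a, exists b, (a != b) && [forall e in B, (a \in e) && (b \in e)]].
  exists [set a; b], (tperm a b); split.
  - have /andP[ae be] := ker e0 e0B.
    by rewrite subUset !sub1set !(subsetP (sub e0 e0B)).
  - exact: tpermK.
  - by move=> v; rewrite !inE => /orP[]/eqP->; rewrite ?tpermL ?tpermR eqxx ?orbT.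
  - by move=> v; rewrite !inE => /orP[]/eqP->; rewrite ?tpermL ?tpermR // eq_sym.
  - by move=> e /ker/andP[ae be]; exists a; rewrite tpermL !inE eqxx.
have {}noker a b : a != b -> exists2 e, e \in B & ~~ ([set a; b] \subset e).
  move=> ab; have [/exists_inP//|all] := boolP [exists e in B, ~~ ([set a; b] \subset e)].
  case/negP: noker; apply/existsP; exists a; apply/existsP; exists b; rewrite ab.
  apply/forall_inP=> e eB; have := exists_inPn all e eB.
  by rewrite negbK subUset !sub1set.
have [e1 e1B ne1] : exists2 e1, e1 \in B & e1 != e0.
  have /card_gt1P[a [b [ae be ab]]] : 1 < #|e0| by rewrite B3.
  have [e1 e1B nab] := noker a b ab; exists e1 => //.
  by apply: contraNneq nab => ->; rewrite subUset !sub1set ae.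
pose P := e0 :&: e1; pose D := e0 :|: e1.
have P2 : #|P| = 2.
  apply/eqP; rewrite eqn_leq BI // andbT -ltnS -(B3 e0 e0B).
  apply/proper_card; rewrite properEneq subsetIl andbT.
  apply: contra ne1 => /eqP/setIidPl e01; rewrite eq_sym eqEcard e01.
  by rewrite !B3.
have D4 : #|D| = 4 by rewrite cardsU -/P P2 !B3.
have out e z : e \in B -> z \in e -> z \notin D -> e :\ z = P.
  move=> eB ze; rewrite inE negb_or => /andP[z0 z1].
  have ez2 : #|e :\ z| = 2 by move: (B3 e eB); rewrite (cardsD1 z) ze => -[].
  have half h : h \in B -> z \notin h -> e :\ z \subset h.
    move=> hB zh; suff <- : e :&: h = e :\ z by apply: subsetIr.
    apply/eqP; rewrite eqEcard ez2 BI // andbT; apply/subsetP=> v.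
    rewrite !inE => /andP[-> vh]; rewrite andbT.
    by apply: contraNneq zh => <-.
  by apply/eqP; rewrite eqEcard ez2 P2 leqnn andbT subsetI !half.
have /cards2P[a [b [ab PE]]] := introT eqP P2.
have [e2 e2B] := noker a b ab; rewrite -PE => ne2.
have inD e : e \in B -> e \subset D.
  move=> eB; apply/subsetP=> z ze; apply: contraT => zD.
  have eP := out e z eB ze zD.
  have ze2 : z \notin e2.
    by apply: contra ne2 => ze2; rewrite -(out e2 z) // subsetDl.
  case/negP: ne2; suff <- : e2 :&: e = P by apply: subsetIl.
  apply/eqP; rewrite eqEcard P2 BI // andbT -eP; apply/subsetP=> v.
  rewrite !inE => /andP[v2 ->]; rewrite andbT.
  by apply: contraNneq ze2 => <-.
have /cards2P[c [d [cd QE]]] : #|D :\: P| == 2.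
  rewrite cardsD (setIidPr _) ?D4 ?P2 //.
  by apply: subset_trans (subsetIl _ _) (subsetUl _ _).
have memP v : v \in P = (v == a) || (v == b) by rewrite PE !inE.
have memQ v : v \in D :\: P = (v == c) || (v == d) by rewrite QE !inE.
have PQ v : v \in P -> v \in D :\: P -> False.
  by move=> vP; rewrite inE vP.
have aP : a \in P by rewrite memP eqxx.
have bP : b \in P by rewrite memP eqxx orbT.
have cQ : c \in D :\: P by rewrite memQ eqxx.
have dQ : d \in D :\: P by rewrite memQ eqxx orbT.
have abcd : uniq [:: a; b; c; d].
  rewrite /= !inE !negb_or ab cd !andbT /=.
  rewrite -!andbA; apply/and4P; split; apply/eqP=> eqPQ.
  - by apply: (PQ a); rewrite // eqPQ.
  - by apply: (PQ a); rewrite // eqPQ.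
  - by apply: (PQ b); rewrite // eqPQ.
  - by apply: (PQ b); rewrite // eqPQ.
have memD v : v \in D -> [\/ v = a, v = b, v = c | v = d].
  move=> vD; case: (boolP (v \in P)) => [|vP].
    by rewrite memP => /orP[]/eqP->; [apply: Or41|apply: Or42].
  have : v \in D :\: P by rewrite inE vP.
  by rewrite memQ => /orP[]/eqP->; [apply: Or43|apply: Or44].
have PD v : v \in P -> v \in D.
  by rewrite !inE => /andP[->].
have QD v : v \in D :\: P -> v \in D by case/setDP.
have [gK ga gb gc gd] := swap4P abcd.
have gD v : v \in D -> swap4 a b c d v \in D.
  by case/memD=> ->; rewrite ?ga ?gb ?gc ?gd; auto.
have gn v : v \in D -> swap4 a b c d v != v.
  by case/memD=> ->; rewrite ?ga ?gb ?gc ?gd // eq_sym.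
exists D, (swap4 a b c d); split=> //.
  by rewrite subUset !sub.
move=> e eB; have /pairsP[u [ue gue _]] :=
  pairs_in_four D4 (B3 e eB) (inD e eB) (inv_inj gK) gD gn.
by exists u; rewrite (subsetP (inD e eB)).
Qed.

Lemma two_of_three e h1 h2 : #|e| = 3 -> 1 < #|e :&: h1| -> 1 < #|e :&: h2| ->
  exists v, [/\ v \in e, v \in h1 & v \in h2].
Proof.
move=> e3 I1 I2.
have /card_gt0P[v] : 0 < #|(e :&: h1) :&: (e :&: h2)|.
  have := cardsUI (e :&: h1) (e :&: h2).
  have : #|(e :&: h1) :|: (e :&: h2)| <= 3.
    by rewrite -e3 subset_leq_card // -setIUr subsetIl.
  case: #|_ :&: (e :&: h2)| => // U3; rewrite addn0 => U.
  by have := leq_add I1 I2; rewrite -U leqNgt ltnS (leq_trans U3).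
by rewrite !inE => /andP[/andP[ve v1] /andP[_ v2]]; exists v.
Qed.

(** Meeting is an equivalence relation on F, since two triples that both share
two points with a third one meet. The triples that meet a given e0 form one
class, to be handled by [intersecting_pairing], and live on vertices that occur
in no other triple. *)
Lemma pairing_exists F :
  {in F, forall e, #|e| = 3} -> {in F &, forall e h, #|e :&: h| != 1} ->
  exists f, [/\ involutive f, forall v, f v != v -> v \in cover F
    & {in F, forall e, pairs f e}].
Proof.
have [n] := ubnP #|F|; elim: n F => // n IHn F leF F3 FI.
have [->|/set0Pn[e0 e0F]] := eqVneq F set0.
  by exists id; split=> [//|v|e]; rewrite ?eqxx ?inE.
pose F1 := [set e in F | [disjoint e & e0]].
pose B := F :\: F1.
have F1F : F1 \subset F by apply/subsetP=> e; rewrite inE => /andP[].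
have e0B : e0 \in B.
  by rewrite !inE e0F -setI_eq0 setIid -cards_eq0 F3.
have BP e : e \in B -> e \in F /\ 1 < #|e :&: e0|.
  rewrite !inE => /andP[+ eF]; rewrite eF -setI_eq0 -cards_eq0 /=.
  by have := FI e e0 eF e0F; case: #|_| => [|[]].
have BI : {in B &, forall e h, 1 < #|e :&: h|}.
  move=> e h /BP[eF e1] /BP[hF h1].
  rewrite setIC in e1; rewrite setIC in h1.
  have [v [v0 ve vh]] := two_of_three (F3 e0 e0F) e1 h1.
  have : 0 < #|e :&: h| by apply/card_gt0P; exists v; rewrite inE ve.
  by have := FI e h eF hF; case: #|_| => [|[]].
have [|||f [fK fF1 fP]] := IHn F1.
- rewrite -ltnS; apply: leq_trans leF; rewrite ltnS; apply/proper_card/properP.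
  by split=> //; exists e0 => //; move: e0B; rewrite inE => /andP[].
- by move=> e /(subsetP F1F); apply: F3.
- by move=> e1 e2 e1F e2F; apply: FI; apply: subsetP F1F _ _.
have [||D [g [DB gK gD gn gP]]] := intersecting_pairing e0B.
- by move=> e /BP[/F3].
- exact: BI.
have Df v : v \in D -> f v = v.
  move=> /(subsetP DB)/bigcupP[e eB ve]; apply/eqP; apply: contraT => /fF1.
  case/bigcupP=> h; rewrite inE => /andP[hF dh] vh.
  have [eF e1] := BP e eB.
  have eh : 1 < #|e :&: h|.
    have : 0 < #|e :&: h| by apply/card_gt0P; exists v; rewrite inE ve.
    by have := FI e h eF hF; case: #|_| => [|[]].
  have [w [we w0 wh]] := two_of_three (F3 e eF) e1 eh.
  by rewrite (disjointFr dh wh) in w0.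
exists (patch D g f); split.
- by apply: patchK => // v vD; rewrite Df.
- move=> v; rewrite /patch; case: ifP => [vD _|_ /fF1].
    by apply: subsetP (subsetP DB v vD); apply/bigcupsP=> e /BP[eF _]; apply: bigcup_sup.
  by apply: subsetP; apply/bigcupsP=> e eF1; apply/bigcup_sup/(subsetP F1F).
move=> e eF; apply/pairsP.
have [eB|eB] := boolP (e \in B).
  have [u [ue uD gue]] := gP e eB; exists u.
  by rewrite /patch uD ue gue gn.
have /pairsP[u [ue fu nfu]] : pairs f e.
  by apply: fP; move: eB; rewrite inE eF andbT negbK.
exists u; rewrite /patch; case: ifP => // uD.
by rewrite Df ?eqxx in nfu.
Qed.

End Intersecting.

(** * Systems of matchings and their large cliques *)

Section Systems.
Variables (V : finType) (E : {set {set V}}) (k : nat).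
Implicit Types (e h S K : {set V}).
Variable cl : {set V} -> 'I_k.+1.
Hypothesis E3 : {in E, forall e, #|e| = 3}.
Hypothesis clI : {in E &, forall e h, cl e = cl h -> #|e :&: h| != 1}.

Definition matching_adj (f : 'I_k.+1 -> V -> V) : rel V :=
  fun u v => (u != v) && [exists i, f i u == v].

Definition big_cliques f := [set K : {set V} | (#|K| == k.+2) && clique (matching_adj f) K].

Definition pairing_system (f : 'I_k.+1 -> V -> V) :=
  (forall i, involutive (f i)) /\ {in E, forall e, pairs (f (cl e)) e}.

Lemma matching_adjP f u v : reflect (u != v /\ exists i, f i u = v) (matching_adj f u v).
Proof.
apply: (iffP andP) => -[uv].
  by case/existsP=> i /eqP fi; split; last exists i.
by case=> i fi; split=> //; apply/existsP; exists i; rewrite fi.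
Qed.

Lemma matching_adj_irr f : irreflexive (matching_adj f).
Proof. by move=> u; rewrite /matching_adj eqxx. Qed.

Lemma matching_adjC f : (forall i, involutive (f i)) -> symmetric (matching_adj f).
Proof.
move=> fK u v; apply/matching_adjP/matching_adjP=> -[uv [i fi]]; split; rewrite 1?eq_sym //;
  by exists i; rewrite -fi fK.
Qed.

Lemma matching_adj_matched f S : matched_on (matching_adj f) f S.
Proof. by move=> u v _ _ /matching_adjP[]. Qed.

Lemma pairing_system_exists : exists f, pairing_system f.
Proof.
pose P i (g : V -> V) :=
  involutive g /\ {in E, forall e, cl e = i -> pairs g e}.
have [i|f fP] := @fin_all_exists _ _ P.
  have [e|e h|f [fK _ fP]] := @pairing_exists V [set e in E | cl e == i].
  - by rewrite inE => /andP[/E3].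
  - rewrite !inE => /andP[eE /eqP ei] /andP[hE /eqP hi].
    by apply: clI; rewrite ?ei.
  by exists f; split=> // e eE ei; apply: fP; rewrite inE eE ei eqxx.
exists f; split=> [i|e eE]; first by case: (fP i).
by have [_] := fP (cl e); apply.
Qed.

Section BigCliques.
Variables (f : 'I_k.+1 -> V -> V) (K : {set V}) (v : V).
Hypotheses (Kbig : K \in big_cliques f) (vK : v \in K).

Let Kcl : {in K &, forall u w, u != w -> matching_adj f u w}.
Proof. by apply/cliqueP; move: Kbig; rewrite inE => /andP[]. Qed.

Let Kv : #|K :\ v| = k.+1.
Proof. by move: Kbig; rewrite inE (cardsD1 v) vK => /andP[/eqP[]]. Qed.

Lemma big_clique_nbrs : nbrs (matching_adj f) setT v = K :\ v.
Proof.
apply/esym/eqP; rewrite eqEcard Kv.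
have := matched_degree (@matching_adj_matched f setT) (in_setT v); rewrite card_ord => ->.
rewrite andbT; apply/subsetP=> u; rewrite !inE => /andP[uv uK] /=.
by apply: Kcl; rewrite // eq_sym.
Qed.

Lemma big_clique_full :
  (forall i, f i v \in K /\ f i v != v) /\ injective (fun i => f i v).
Proof.
have [|fN f_inj] := matched_full (@matching_adj_matched f setT) (in_setT v).
  by rewrite big_clique_nbrs Kv card_ord.
by split=> // i; have := fN i; rewrite big_clique_nbrs !inE => /andP[].
Qed.

End BigCliques.

(** A clique K on k + 2 vertices is coloured with a repetition of colour 0 on a
pair a, [f ord0 a]. This condition makes the triples of class 0 through that
pair harmless: their third vertex is in K or unmatched in class 0, hence not
of colour 0. *)
Definition settled f := [forall K in big_cliques f, forall e in E,
  (cl e == ord0) ==> [forall a in K, forall y in e,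
    (a \in e) && (f ord0 a \in e) ==> (y \in K) || (f ord0 y == y)]].

Lemma settledP f : reflect (forall K e a y, K \in big_cliques f -> e \in E ->
    cl e = ord0 -> a \in K -> a \in e -> f ord0 a \in e -> y \in e ->
    y \notin K -> f ord0 y = y)
  (settled f).
Proof.
apply: (iffP forall_inP) => [st K e a y Kb eE ce aK ae fae ye yK|st K Kb].
  have /forall_inP/(_ e eE)/implyP := st K Kb; rewrite ce eqxx => /(_ isT).
  move=> /forall_inP/(_ a aK)/forall_inP/(_ y ye); rewrite ae fae (negbTE yK).
  by move/eqP.
apply/forall_inP=> e eE; apply/implyP=> /eqP ce; apply/forall_inP=> a aK.
apply/forall_inP=> y ye; apply/implyP=> /andP[ae fae].
by have [//|yK /=] := boolP (y \in K); apply/eqP; apply: (st K e a).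
Qed.

Definition update0 (f : 'I_k.+1 -> V -> V) g i := if i == ord0 then g else f i.

(** The quantity to be minimised: its first term drops when a four-element piece
of class 0 that spoils a clique is rematched, its second term when a useless
pair of class 0 is removed. *)
Definition unrest f := #|big_cliques f| + #|[set v | f ord0 v != v]|.

Lemma three_elements (e : {set V}) a b c w : #|e| = 3 -> uniq [:: a; b; c] ->
  a \in e -> b \in e -> c \in e -> w \in e -> [\/ w = a, w = b | w = c].
Proof.
move=> e3 abc ae be ce we.
have abcE : [set a; b; c] = e.
  apply/eqP; rewrite eqEcard !subUset !sub1set ae be ce e3 /=.
  move: abc; rewrite /= !inE negb_or andbT => /andP[/andP[ab ac] bc].
  by rewrite setUC cardsU1 !inE negb_or eq_sym ac eq_sym bc cards2 ab.
by move: we; rewrite -abcE !inE => /orP[/orP[]|]/eqP->;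
  [apply: Or31 | apply: Or32 | apply: Or33].
Qed.

Lemma same_class_share e h v : e \in E -> h \in E -> cl e = cl h ->
  v \in e -> v \in h -> exists w, [/\ w != v, w \in e & w \in h].
Proof.
move=> eE hE ceh ve vh; have := clI eE hE ceh.
rewrite (cardsD1 v) inE ve vh add1n eqSS -lt0n => /card_gt0P[w].
by rewrite !inE => /and3P[wv we wh]; exists w.
Qed.

(** Let e = a b y spoil a clique Q, where b and z are the class-0 partners of a
and y; then y and z are outside Q. If no triple of class 0 contains y and z,
this pair can be dropped. Otherwise all class-0 triples containing one of the
two pairs lie inside D = {a, b, y, z}, so that class 0 may as well match a with
y and b with z. This destroys the clique Q and creates no new one. *)
Lemma unsettled_step f : 0 < k -> pairing_system f -> ~~ settled f ->
  exists2 f', pairing_system f' & unrest f' < unrest f.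
Proof.
move=> k0 [fK fE]; case/forall_inPn=> Q Qb /forall_inPn[e eE].
rewrite negb_imply => /andP[/eqP ce /forall_inPn[a aQ /forall_inPn[y ye]]].
rewrite negb_imply negb_or => /andP[/andP[ae be] /andP[yQ yz]].
set b := f ord0 a in be; set z := f ord0 y in yz.
have [fQ f_inj] := big_clique_full Qb aQ.
have [bQ ba] := fQ ord0; rewrite -/b in bQ ba.
have outQ i u v : f i u = v -> v \in Q -> u \in Q.
  move=> fuv vQ; have [/(_ i)[+ _] _] := big_clique_full Qb vQ.
  by rewrite -fuv fK.
have zQ : z \notin Q by apply: contra yQ; apply: outQ (erefl z).
have fb : f ord0 b = a by rewrite /b fK.
have fz : f ord0 z = y by rewrite /z fK.
have ya : y != a by apply: contraNneq yQ => ->.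
have yb : y != b by apply: contraNneq yQ => ->.
have za : z != a by apply: contraNneq zQ => ->.
have zb : z != b by apply: contraNneq zQ => ->.
have ayb : uniq [:: a; y; b; z].
  rewrite /= !inE !negb_or (eq_sym a) ya (eq_sym a b) ba (eq_sym a z) za yb.
  by rewrite (eq_sym y z) yz (eq_sym b z) zb.
have [/exists_inP[h hE /and3P[/eqP ch yh zh]]|noyz] :=
  boolP [exists h in E, [&& cl h == ord0, y \in h & z \in h]]; last first.
  pose f' := update0 f (patch [set y; z] id (f ord0)).
  have f'P i v : f' i v = if (i == ord0) && (v \in [set y; z]) then v else f i v.
    by rewrite /f' /update0 /patch; case: (altP (i =P ord0)) => [->|].
  exists f'; first split.
  - move=> i; rewrite /f' /update0; case: ifP => _; last exact: fK.
    apply: patchK => // v; rewrite !inE => /orP[]/eqP->; rewrite ?fz ?eqxx ?orbT //.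
  - move=> h hE; have /pairsP[u [uh fuh nfu]] := fE h hE.
    apply/pairsP; exists u; rewrite f'P; case: ifP => // /andP[/eqP ch].
    rewrite ch in fuh; rewrite !inE => uyz; case/exists_inP: noyz; exists h => //.
    by rewrite ch eqxx; case/orP: uyz uh fuh => /eqP-> /=; rewrite ?fz => -> ->.
  rewrite /unrest -addnS leq_add //.
    apply: subset_leq_card; apply/subsetP=> K; rewrite !inE => /andP[-> /cliqueP Kc].
    apply/cliqueP=> u v uK vK uv; have /matching_adjP[_ [i]] := Kc u v uK vK uv.
    rewrite f'P; case: ifP => _ fi; first by rewrite fi eqxx in uv.
    by apply/matching_adjP; split=> //; exists i.
  apply/proper_card/properP; split.
    apply/subsetP=> v; rewrite !inE f'P eqxx /=.
    by case: ifP; rewrite ?eqxx.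
  by exists y; rewrite !inE // f'P !inE !eqxx.
have abE w : w \in e -> [\/ w = a, w = b | w = y].
  by apply: three_elements; rewrite ?E3 //= !inE negb_or eq_sym ba eq_sym ya eq_sym yb.
(* t, in e and h, is a or b: so h contains y, z and one of a and b *)
have [t [ty te th]] := same_class_share eE hE (etrans ce (esym ch)) ye yh.
have tab : t = a \/ t = b.
  by case: (abE t te) => [||tE]; auto; rewrite tE eqxx in ty.
have tz : t != z by case: tab => ->; rewrite eq_sym.
have yztE w : w \in h -> [\/ w = y, w = z | w = t].
  by apply: three_elements; rewrite ?E3 //= !inE negb_or eq_sym yz eq_sym ty eq_sym tz.
pose D := [set a; y; b; z].
have memD v : (v \in D) = [|| v == a, v == y, v == b | v == z].
  by rewrite !inE -!orbA.
have [gK ga gy gb gz] := swap4P ayb.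
set g := swap4 a y b z in gK ga gy gb gz.
have gD v : v \in D -> g v \in D.
  by rewrite !memD => /or4P[]/eqP->; rewrite ?ga ?gy ?gb ?gz eqxx ?orbT.
have gn v : v \in D -> g v != v.
  by rewrite !memD => /or4P[]/eqP->; rewrite ?ga ?gy ?gb ?gz // eq_sym.
have fD v : v \in D -> f ord0 v \in D.
  by rewrite !memD => /or4P[]/eqP->; rewrite -/b -/z ?fb ?fz eqxx ?orbT.
have D4 : #|D| = 4.
  rewrite (eq_card (_ : D =i [:: a; y; b; z])) ?(card_uniqP ayb) // => v.
  by rewrite memD !inE.
pose f' := update0 f (patch D g (f ord0)).
have f'0 v : f' ord0 v = if v \in D then g v else f ord0 v by [].
have f'i i v : i != ord0 -> f' i v = f i v.
  by rewrite /f' /update0 => /negbTE->.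
have f'K i : involutive (f' i).
  by rewrite /f' /update0; case: ifP => _; [apply: patchK | apply: fK].
have inD h' u : h' \in E -> cl h' = ord0 -> u \in D -> u \in h' -> f ord0 u \in h' ->
    h' \subset D.
  move=> h'E ch'.
  have cab : a \in h' -> b \in h' -> h' \subset D.
    move=> ah bh; have [s [st sh' sh]] : exists s, [/\ s != t, s \in h' & s \in h].
      by apply: same_class_share; rewrite ?ch' //; case: tab => ->.
    apply/subsetP=> w; rewrite memD.
    have abs : uniq [:: a; b; s].
      rewrite /= !inE negb_or (eq_sym a b) ba /=.
      case: (yztE s sh) => [->|->|sE]; last by rewrite sE eqxx in st.
        by rewrite (eq_sym a) ya (eq_sym b) yb.
      by rewrite (eq_sym a) za (eq_sym b) zb.
    case/(three_elements (E3 h'E) abs ah bh sh') => ->; rewrite ?eqxx ?orbT //.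
    by case: (yztE s sh) => [->|->|sE]; rewrite ?eqxx ?orbT //; rewrite sE eqxx in st.
  have cyz : y \in h' -> z \in h' -> h' \subset D.
    move=> yh' zh'; have [s [sy sh' se]] : exists s, [/\ s != y, s \in h' & s \in e].
      by apply: same_class_share; rewrite ?ch'.
    have sab : s = a \/ s = b.
      by case: (abE s se) => [||sE]; auto; rewrite sE eqxx in sy.
    have yzs : uniq [:: y; z; s].
      rewrite /= !inE negb_or (eq_sym y z) yz (eq_sym y s) sy /=.
      by case: sab => ->; rewrite ?za ?zb.
    apply/subsetP=> w; rewrite memD.
    case/(three_elements (E3 h'E) yzs yh' zh' sh') => ->; rewrite ?eqxx ?orbT //.
    by case: sab => ->; rewrite eqxx ?orbT.
  by rewrite memD => /or4P[]/eqP->; rewrite -/b -/z ?fb ?fz; auto.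
have f'S : pairing_system f'.
  split=> // h' h'E; have /pairsP[u [uh fuh nfu]] := fE h' h'E.
  have [ch'|ch'] := eqVneq (cl h') ord0; last first.
    by apply/pairsP; exists u; rewrite f'i.
  rewrite ch' in fuh nfu *; have [uD|uD] := boolP (u \in D); last first.
    by apply/pairsP; exists u; rewrite f'0 (negbTE uD).
  have h'D := inD h' u h'E ch' uD uh fuh.
  have /pairsP[v [vh gv ngv]] := pairs_in_four D4 (E3 h'E) h'D (inv_inj gK) gD gn.
  by apply/pairsP; exists v; rewrite f'0 (subsetP h'D).
exists f' => //; rewrite /unrest -addSn leq_add //; last first.
  apply: subset_leq_card; apply/subsetP=> v; rewrite !inE f'0.
  case: ifP => // + _; rewrite memD.
  by case/or4P=> /eqP->; rewrite -/b -/z ?fb ?fz // eq_sym.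
have keep i u v : u \in Q -> u != a -> u != b -> f i u = v -> f' i u = v.
  move=> uQ ua ub <-; have [->|i0] := eqVneq i ord0; last exact: f'i.
  rewrite f'0 memD (negbTE ua) (negbTE ub) /=.
  have [uy|_] := eqVneq u y; first by rewrite uy (negbTE yQ) in uQ.
  by have [uz|//] := eqVneq u z; rewrite uz (negbTE zQ) in uQ.
have [w [wQ wa wb]] : exists w, [/\ w \in Q, w != a & w != b].
  have : 0 < #|Q :\ a :\ b|.
    move: Qb; rewrite inE (cardsD1 a) aQ (cardsD1 b) !inE ba bQ /=.
    by rewrite !add1n !eqSS => /andP[/eqP-> _].
  by case/card_gt0P=> w; rewrite !inE => /and3P[]; exists w.
have Qcl u v : u \in Q -> v \in Q -> u != v -> matching_adj f u v.
  by move: Qb; rewrite inE => /andP[_ /cliqueP]; apply.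
(* a large clique of the new graph through a new pair s r would contain w,
   which has no neighbour outside Q *)
have cross K' s r : K' \in big_cliques f' -> s \in K' -> r \in K' ->
    s \in Q -> r \notin Q -> (s == a) || (s == b) -> False.
  move=> K'b sK rK sQ rQ sab.
  have K'cl : {in K' &, forall u v, u != v -> matching_adj f' u v}.
    by apply/cliqueP; move: K'b; rewrite inE => /andP[].
  have sw : w != s by case/orP: sab => /eqP->.
  have ws : matching_adj f' s w.
    rewrite (matching_adjC f'K); have /matching_adjP[_ [i fi]] := Qcl w s wQ sQ sw.
    by apply/matching_adjP; split=> //; exists i; apply: keep.
  have wK : w \in K'.
    have := big_clique_nbrs K'b sK => /setP/(_ w).
    by rewrite !inE ws => /esym/andP[].
  have wr : w != r by apply: contraNneq rQ => <-.
  have /matching_adjP[_ [i f'i_w]] := K'cl w r wK rK wr.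
  case/negP: rQ; rewrite -f'i_w (keep i w (f i w)) //.
  by have [/(_ i)[]] := big_clique_full Qb wQ.
apply/proper_card/properP; split; last first.
  exists Q => //; rewrite inE negb_and; apply/orP; right.
  apply/negP=> /cliqueP/(_ a b aQ bQ); rewrite eq_sym ba => /(_ isT)/matching_adjP[_ [i]].
  have [->|i0] := eqVneq i ord0.
    by rewrite f'0 memD eqxx ga => /= yb'; rewrite yb' eqxx in yb.
  by rewrite f'i // => /f_inj ii; rewrite ii eqxx in i0.
apply/subsetP=> K' K'b; rewrite inE; move: (K'b); rewrite inE => /andP[-> /cliqueP K'cl].
apply/cliqueP=> u v uK vK uv; have /matching_adjP[_ [i f'u]] := K'cl u v uK vK uv.
apply/matching_adjP; split=> //; exists i.
have [i0|i0] := eqVneq i ord0; last by rewrite -f'u f'i.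
rewrite i0 f'0 in f'u *; case: ifP f'u => // + gu.
rewrite memD => /or4P[]/eqP uE; subst u v; rewrite ?ga ?gy ?gb ?gz in uK vK uv *.
- by case: (cross K' a y); rewrite ?eqxx.
- by case: (cross K' a y); rewrite ?eqxx.
- by case: (cross K' b z); rewrite ?eqxx ?orbT.
- by case: (cross K' b z); rewrite ?eqxx ?orbT.
Qed.

Lemma settled_system : 0 < k -> exists2 f, pairing_system f & settled f.
Proof.
move=> k0; have [f fS] := pairing_system_exists.
have [n] := ubnP (unrest f); elim: n f fS => // n IHn f fS lef.
have [st|/(unsettled_step k0 fS)[f' f'S ltf]] := boolP (settled f); first by exists f.
by apply: (IHn f'); rewrite // (leq_trans ltf).
Qed.

Lemma clique_coloring f K : (forall i, involutive (f i)) -> K \in big_cliques f ->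
  exists c : V -> 'I_k.+1, {in K &, forall u v, u != v -> c u = c v ->
    f ord0 u = v /\ c u = ord0}.
Proof.
move=> fK Kb; have cardK : #|K| = k.+2 by move: Kb; rewrite inE => /andP[/eqP].
have /card_gt0P[a aK] : 0 < #|K| by rewrite cardK.
have [/(_ ord0)[bK ba] _] := big_clique_full Kb aK.
set b := f ord0 a in bK ba.
pose D := K :\ a :\ b.
have cardD : #|D| = k.
  by move: cardK; rewrite (cardsD1 a) aK (cardsD1 b) !inE ba bK !add1n => -[].
pose c v : 'I_k.+1 := if v \in D then inord (index v (enum D)).+1 else ord0.
have cD v : v \in D -> c v = (index v (enum D)).+1 :> nat.
  move=> vD; rewrite /c vD inordK // ltnS -cardD cardE index_mem mem_enum //.
have cN v : v \notin D -> c v = ord0 by rewrite /c => /negbTE->.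
have memD v : v \in K -> v \notin D -> v = a \/ v = b.
  move=> vK; rewrite !inE vK andbT negb_and !negbK.
  by case/orP=> /eqP; [right|left].
exists c => u v uK vK uv cuv.
have [uD|uD] := boolP (u \in D); have [vD|vD] := boolP (v \in D).
- have := congr1 val cuv; rewrite /= !cD // => -[iuv].
  case/eqP: uv; rewrite -[u](nth_index u (s := enum D)) ?mem_enum // iuv.
  by rewrite nth_index ?mem_enum.
- by have := congr1 val cuv; rewrite /= cD // cN.
- by have := congr1 val cuv; rewrite /= cN // cD.
split; last exact: cN.
case: (memD u uK uD) (memD v vK vD) uv => -> [] -> //; rewrite ?eqxx //.
by rewrite /b fK.
Qed.

(** * The colouring *)

(** The cliques on k + 2 vertices are coloured by [clique_coloring], the rest by
[admissible_coloring], where the colour 0 avoids the vertices unmatched in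
class 0. *)
Lemma system_coloring f : 0 < k -> pairing_system f -> settled f -> ~~ odd k ->
  exists c : V -> 'I_k.+1,
    {in E, forall e, exists u v, [/\ u \in e, v \in e & c u != c v]}.
Proof.
move=> k0 [fK fE] /settledP st keven.
have k2 : 1 < k by case: (k) k0 keven => [|[]].
have adjC := matching_adjC fK; have adj_irr := @matching_adj_irr f.
pose R := ~: cover (big_cliques f).
pose Y := [set v | f ord0 v == v].
have admR : admissible (matching_adj f) k Y R.
  split=> [v vR|K KR cardK|B BR BY].
  - have [vY|vY] := boolP (v \in Y).
      apply: leq_trans (_ : #|[set f (lift ord0 i) v | i : 'I_k]| <= _); last first.
        by apply: leq_trans (leq_imset_card _ _) _; rewrite card_ord.
      apply/subset_leq_card/subsetP=> u; rewrite in_nbrs => /andP[_ /matching_adjP[vu [i fi]]].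
      case: (unliftP ord0 i) fi => [j|] -> fi; first by apply/imsetP; exists j.
      by move: vY; rewrite inE fi eq_sym (negbTE vu).
    rewrite add1n; apply: leq_trans (matched_degree (@matching_adj_matched f R) vR) _.
    by rewrite card_ord.
  - apply/negP=> Kcl.
    have Kb : K \in big_cliques f by rewrite inE cardK eqxx.
    have /card_gt0P[v vK] : 0 < #|K| by rewrite cardK.
    have := subsetP KR v vK; rewrite inE => /bigcupP[]; by exists K.
  - apply: (@even_matchings_coloring _ (matching_adj f) _ _ _ (fun i : 'I_k => f (lift ord0 i)));
      rewrite ?card_ord // => u v uB vB /matching_adjP[uv [i fi]].
    case: (unliftP ord0 i) fi => [j|] -> fi; first by exists j.
    suff : 1 < #|B :\: Y| by rewrite ltnNge BY.
    apply/card_gt1P; exists u, v; split=> //.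
      by rewrite !inE uB fi eq_sym uv.
    by rewrite !inE vB -fi fK fi uv.
have [cR cRP cRY] := admissible_coloring adjC adj_irr k2 admR.
pose good K (c : V -> 'I_k.+1) := K \in big_cliques f ->
  {in K &, forall u v, u != v -> c u = c v -> f ord0 u = v /\ c u = ord0}.
have [K|cK cKP] := @fin_all_exists _ _ good.
  have [Kb|Kb] := boolP (K \in big_cliques f); last by exists (fun=> ord0); move/negP: Kb.
  by have [c cP] := clique_coloring fK Kb; exists c.
pose c v := if [pick K in big_cliques f | v \in K] is Some K then cK K v else cR v.
have c_clique K v : K \in big_cliques f -> v \in K -> c v = cK K v.
  move=> Kb vK; rewrite /c.
  case: pickP => [K' /andP[K'b vK']|/(_ K)]; last by rewrite Kb vK.
  suff -> : K' = K by [].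
  by rewrite -(setD1K vK') -(setD1K vK) -!(@big_clique_nbrs f).
have c_rest v : v \in R -> c v = cR v.
  rewrite inE /c => vR; case: pickP => // K /andP[Kb vK].
  by case/negP: vR; apply/bigcupP; exists K.
have fclique K v i : K \in big_cliques f -> v \in K -> f i v \in K.
  by move=> Kb vK; have [/(_ i)[]] := big_clique_full Kb vK.
exists c => e eE; have /pairsP[u [ue we wu]] := fE e eE.
set i := cl e in we wu; set w := f i u in we wu.
have [cuw|cuw] := eqVneq (c u) (c w); last by exists u, w.
have uw : u != w by rewrite eq_sym.
have adj_uw : matching_adj f u w by apply/matching_adjP; split=> //; exists i.
have [uR|] := boolP (u \in R).
  have wR : w \in R.
    apply: contraLR uR; rewrite !inE !negbK => /bigcupP[K Kb wK].
    by apply/bigcupP; exists K; rewrite // -[u](fK i) fclique.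
  by have := cRP u w uR wR adj_uw; rewrite -!c_rest // cuw eqxx.
rewrite inE negbK => /bigcupP[K Kb uK].
have wK : w \in K by apply: fclique.
(* u and w have the same colour in K, so they are the repetition in K *)
have [|f0u cu0] := cKP K Kb u w uK wK uw; first by rewrite -!c_clique.
have ie : cl e = ord0.
  by have [_ f_inj] := big_clique_full Kb uK; apply/esym/f_inj; rewrite f0u.
have [y] : exists y, y \in e :\ u :\ w.
  apply/card_gt0P; have := E3 eE.
  by rewrite (cardsD1 u) ue (cardsD1 w) !inE wu we !add1n => -[->].
rewrite !inE => /and3P[yw yu ye]; exists u, y; split=> //.
rewrite (c_clique K u) // cu0; have [yK|yK] := boolP (y \in K).
  rewrite (c_clique K y) //; apply/eqP=> cy.
  have [||f0y _] := cKP K Kb u y uK yK; rewrite 1?eq_sym ?cu0 //.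
  by rewrite -f0y f0u eqxx in yw.
have fy : f ord0 y = y by apply: (st K e u); rewrite // f0u.
have yR : y \in R.
  rewrite inE; apply/negP=> /bigcupP[K' K'b yK'].
  by have [/(_ ord0)[_]] := big_clique_full K'b yK'; rewrite fy eqxx.
have := cRY y yR; rewrite avoid_list_mem inE fy eqxx /= c_rest //.
by rewrite eq_sym.
Qed.

Lemma class_coloring : 0 < k ->
  exists c : V -> 'I_k.+1,
    {in E, forall e, exists u v, [/\ u \in e, v \in e & c u != c v]}.
Proof.
move=> k0; have [f fS st] := settled_system k0.
have [kodd|keven] := boolP (odd k); last exact: system_coloring fS st keven.
have [fK fE] := fS.
have [||||c cP] := @even_matchings_coloring _ (matching_adj f) (matching_adjC fK) (@matching_adj_irr f)
    _ f fK 'I_k.+1 setT; rewrite ?card_ord //= ?kodd //.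
  exact: matching_adj_matched.
exists c => e eE; have /pairsP[u [ue fue nfu]] := fE e eE.
exists u, (f (cl e) u); split=> //; apply: cP; rewrite ?inE //.
by apply/matching_adjP; rewrite eq_sym; split=> //; exists (cl e).
Qed.

End Systems.

Theorem theorem13 (H : hypergraph) (hH : uniform 3 H)
    (hchi : 2 <= chromatic_number (intersection_graph1 H)) :
  chromatic_number (edges H) <= chromatic_number (intersection_graph1 H).
Proof.
have E3 : {in edges H, forall e : {set vertex H}, #|e| = 3}.
  by move=> e eE; have /forall_inP/(_ e eE)/eqP := hH.
have [e0 e0E] := set0Pn _ (edges_neq0 H).
have edge_gt0 : 0 < #|edge_of H| by apply/card_gt0P; exists (Sub e0 e0E).
have inj_col : colorable (intersection_graph1 H) #|edge_of H|.
  apply/existsP; exists [ffun e => enum_rank e].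
  apply/proper_coloring_graphP=> e f /andP[ef _].
  by rewrite !ffunE (inj_eq enum_rank_inj).
have [_ /existsP[col /proper_coloring_graphP colP] _] :=
  chromatic_numberP edge_gt0 inj_col.
move: (chromatic_number _) hchi col colP => [|k] //; rewrite ltnS => k0 col colP.
pose cl e := if insub e is Some e' then col e' else ord0.
have [|c cP] := @class_coloring _ (edges H) k cl E3 _ k0.
  move=> e f eE fE; rewrite /cl (insubT (mem (edges H)) eE) (insubT (mem (edges H)) fE).
  move=> cef; apply/negP=> ef.
  have := colP (Sub e eE) (Sub f fE); rewrite cef eqxx => /(_ _)/negP[] //.
  rewrite /adj1 /= ef andbT -val_eqE /=; apply: contraTneq ef => ->.
  by rewrite setIid E3.
have [] // := @chromatic_numberP _ (edges H) k.+1 isT.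
apply/existsP; exists (finfun c); apply/forall_inP=> e eE.
have [u [v [ue ve cuv]]] := cP e eE.
apply: contra cuv => /forall_inP/(_ u ue)/forall_inP/(_ v ve).
by rewrite !ffunE.
Qed.
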